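(* There exist two connected, asymmetric, finite (uncolored) graphs $G_1$ and $G_2$ such that $G_1\not\cong G_2$ but $G_1\cong_q G_2$ (that is, $G_1$ and $G_2$ are quantum isomorphic but not isomorphic).
   Context: A graph $G=(V(G),E(G))$ is finite, undirected, without loops or parallel edges. A graph is asymmetric if its automorphism group $\mathrm{Aut}(G)$ is trivial. A magic unitary is a matrix with entries in a nonzero unital $C^*$-algebra, all of whose entries $u_{ij}$ are projections ($u_{ij}=u_{ij}^*=u_{ij}^2$) and each of whose rows and columns sums to $1$. Two graphs $G,G'$ with adjacency matrices $A_G,A_{G'}$ are quantum isomorphic, denoted $G\cong_q G'$, if there are a nonzero unital $C^*$-algebra $\mathcal{A}$ (not required to be finite-dimensional) and a magic unitary $u=[u_{ij}]_{i\in V(G),j\in V(G')}$ with entries in $\mathcal{A}$ such that $A_G u=uA_{G'}$. *)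

(* Defs.v *)
From HB Require Import structures.
From mathcomp Require Import all_boot all_order all_algebra fingroup perm.
From mathcomp Require Import complex.
From mathcomp Require Import reals.

Set Implicit Arguments.
Unset Strict Implicit.
Unset Printing Implicit Defensive.

Import GRing.Theory Num.Theory.

Local Open Scope ring_scope.

Record sgraph := SGraph {
  vertex :> finType;
  adj : rel vertex;
  adj_sym : symmetric adj;
  adj_irrefl : irreflexive adj
}.

Definition connected_graph (G : sgraph) : Prop :=
  (0 < #|G|)%N /\ forall x y : G, connect (@adj G) x y.

Definition graph_iso (G G' : sgraph) : Prop :=
  exists2 f : G -> G', bijective f & forall x y, adj (f x) (f y) = adj x y.

Definition graph_aut (G : sgraph) : {set {perm G}} :=
  [set s : {perm G} | [forall x, forall y, adj (s x) (s y) == adj x y]].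

Lemma graph_aut_group_set (G : sgraph) : group_set (graph_aut G).
Proof.
apply/group_setP; split=> [|s t].
  by rewrite inE; apply/forallP=> x; apply/forallP=> y; rewrite !perm1.
rewrite !inE => /forallP sP /forallP tP.
apply/forallP=> x; apply/forallP=> y; rewrite !permM.
by rewrite (eqP (forallP (tP _) _)) (eqP (forallP (sP _) _)).
Qed.

Canonical graph_aut_group (G : sgraph) : {group {perm G}} :=
  Group (graph_aut_group_set G).

Definition asymmetric (G : sgraph) : Prop := graph_aut G = 1%g.

(* Unital complex C*-algebras.  The zero algebra is excluded, since
   [GRing.Algebra] requires [1 != 0].  The norm is a field of its own rather
   than that of [completeNormedModType R[i]]: the hierarchy already fixes
   [Num.NumDomain], which is commutative, as the join of rings and normed
   Z-modules, so a noncommutative normed algebra cannot be added to it.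
   Nonnegativity of [cnorm] follows from [cnormD] and [cnormZ]. *)
HB.mixin Record isCStarAlgebra (R : realType) A of GRing.Algebra R[i] A := {
  star : A -> A;
  starD : forall x y : A, star (x + y) = star x + star y;
  starZ : forall (a : R[i]) (x : A), star (a *: x) = a^* *: star x;
  starM : forall x y : A, star (x * y) = star y * star x;
  starK : forall x : A, star (star x) = x;
  cnorm : A -> R;
  cnorm_eq0 : forall x : A, cnorm x = 0 -> x = 0;
  cnormD : forall x y : A, cnorm (x + y) <= cnorm x + cnorm y;
  cnormZ : forall (a : R[i]) (x : A),
    cnorm (a *: x) = ComplexField.Normc.normc a * cnorm x;
  cnormM : forall x y : A, cnorm (x * y) <= cnorm x * cnorm y;
  cnorm_starM : forall x : A, cnorm (star x * x) = cnorm x ^+ 2;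
  cnorm_complete : forall x : nat -> A,
    (forall e : R, 0 < e ->
       exists N, forall m n, (N <= m)%N -> (N <= n)%N ->
         cnorm (x m - x n) < e) ->
    exists l : A, forall e : R, 0 < e ->
      exists N, forall n, (N <= n)%N -> cnorm (x n - l) < e
}.

#[short(type="cstarAlgType")]
HB.structure Definition CStarAlgebra (R : realType) :=
  {A of GRing.Algebra R[i] A & isCStarAlgebra R A}.

Definition projection (R : realType) (A : cstarAlgType R) (p : A) : Prop :=
  p = star p /\ p = p ^+ 2.

Definition magic_unitary (R : realType) (A : cstarAlgType R) (m n : nat)
    (u : 'M[A]_(m, n)) : Prop :=
  [/\ forall i j, projection (u i j),
      forall i, \sum_j u i j = 1
    & forall j, \sum_i u i j = 1].

(* Rows and columns are indexed by the enumeration of the vertices. *)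
Definition adjmx (A : pzSemiRingType) (G : sgraph) : 'M[A]_#|G| :=
  \matrix_(i, j) (adj (enum_val i : G) (enum_val j))%:R.

Definition quantum_iso (R : realType) (G G' : sgraph) : Prop :=
  exists (A : cstarAlgType R) (u : 'M[A]_(#|G|, #|G'|)),
    magic_unitary u /\ adjmx A G *m u = u *m adjmx A G'.

(* Main.v *)
From HB Require Import structures.
Require Import Defs.
From mathcomp Require Import all_boot all_order all_algebra fingroup perm.
From mathcomp Require Import ring lra.
From mathcomp Require Import complex sesquilinear spectral.
From mathcomp Require Import boolp classical_sets reals.

Set Implicit Arguments.
Unset Strict Implicit.
Unset Printing Implicit Defensive.

Import Order.TTheory GRing.Theory Num.Theory.
Import ComplexField.Normc.

Local Open Scope ring_scope.
Local Open Scope sesquilinear_scope.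

(** Why such graphs exist.

    Consider the involutions [x <> 1] of SL_4(F_3), and look for functions [f]
    from them to Z/2 with [f (x y) = f x + f y] whenever [x] and [y] commute and
    are distinct.  This is a system of linear equations over Z/2, and its
    solutions over two kinds of values differ.

    - Classically there is only [f = 0], so in particular [f (-1) = 0]
      ([partial_character_trivial], [observable_classical]).  Commuting pairs are
      few, but they suffice to show that [f] does not change when the diagonal
      matrix [x = diag(-1, -1, 1, 1)] is conjugated by certain transvections: the
      change is a function on F_3^2, with values in Z/2, that is additive along
      enough pairs of vectors to vanish at [2 e], and 2 is invertible.  Products
      of these transvections carry [x] to [diag(-1, 1, -1, 1)], so that [f]
      vanishes at the product of the two.
    - In operators there is a solution with value -1 at [-1]: let SL_4(F_3) act
      on the odd functions on F_3^4.  Involutions act by self-adjoint operators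
      of square 1, products of commuting ones are respected, and the central
      element acts as the scalar -1 ([odd_repM], [odd_repN1]).

    A system of equations [x_(c0 q) + x_(c1 q) = x_(c2 q)] becomes a graph in the
    manner of Cai, Furer and Immerman: a pair of vertices [(i, 0), (i, 1)] for
    each unknown, and four vertices for each equation, one for each assignment
    satisfying it, joined to the values that it gives to the three unknowns.  If
    the classes of vertices are coloured, an automorphism shifts the values of
    the unknown [i] by [f i], where [f] solves the system.  So there is none but
    the identity.  Now mark one of the two values of the unknown [-1].  The two
    markings give coloured graphs that are not isomorphic, since an isomorphism
    would be a solution with [f (-1) = 1].  But the spectral projections of the
    operator solution form a magic unitary between them, because -1 at the marked
    unknown makes it exchange the two values ([sys_graph_quantum_iso]).

    The colours are removed by adding a rigid frame to the graph ([frame]), to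
    which magic unitaries extend by the identity ([frame_quantum_iso]).  Finally
    the operators have to live in a C*-algebra; it is the algebra of complex
    matrices with the operator norm. *)

(** * Magic unitaries indexed by vertices *)

Section QuantumIsoFun.
Variables (R : realType) (A : cstarAlgType R) (G G' : sgraph) (U : G -> G' -> A).
Hypothesis U_proj : forall v w, projection (U v w).
Hypothesis U_row : forall v, \sum_w U v w = 1.
Hypothesis U_col : forall w, \sum_v U v w = 1.
Hypothesis U_adj : forall v w,
  \sum_(v' | adj v v') U v' w = \sum_(w' | adj w' w) U v w'.

Lemma quantum_iso_of_fun : quantum_iso R G G'.
Proof.
exists A, (\matrix_(i, j) U (enum_val i) (enum_val j)); split; first split.
- by move=> i j; rewrite mxE.
- move=> i; rewrite -(U_row (enum_val i)) [RHS]big_enum_val.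
  by apply: eq_bigr => j _; rewrite mxE.
- move=> j; rewrite -(U_col (enum_val j)) [RHS]big_enum_val.
  by apply: eq_bigr => i _; rewrite mxE.
apply/matrixP => i j; rewrite !mxE.
have := U_adj (enum_val i) (enum_val j).
rewrite big_mkcond [RHS]big_mkcond big_enum_val [RHS]big_enum_val /= => eqU.
transitivity (\sum_(k < #|G|) if adj (enum_val i) (enum_val k)
                              then U (enum_val k) (enum_val j) else 0).
  by apply: eq_bigr => k _; rewrite !mxE; case: ifP; rewrite ?mul1r ?mul0r.
rewrite eqU; apply: eq_bigr => k _; rewrite !mxE.
by case: ifP; rewrite ?mulr1 ?mulr0.
Qed.

End QuantumIsoFun.

Section CStarFacts.
Variables (R : realType) (A : cstarAlgType R).

Lemma star1 : star (1 : A) = 1.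
Proof. by have := starM (star 1) (1 : A); rewrite starK !mulr1 starK. Qed.

Lemma star0 : star (0 : A) = 0.
Proof.
by have := starD (0 : A) 0; rewrite addr0 => /eqP; rewrite -subr_eq subrr => /eqP.
Qed.

Lemma projection_nat (b : bool) : projection (b%:R : A).
Proof. by case: b; split; rewrite ?star1 ?star0 ?expr1n ?expr0n. Qed.

End CStarFacts.

(** * Removing colours *)

Section Frame.
Variables (W C : finType) (e : rel W).
Hypotheses (e_sym : symmetric e) (e_irrefl : irreflexive e).
Hypothesis C_big : (2 < #|C|)%N.

(** The vertices of the graph [e] on [W], coloured by [k], are joined to a skeleton
    from which the colours can be recovered: one rung for each colour, an apex and
    a leaf ([true] and [false]).  The leaf hangs from the apex, which is joined to
    all of [W].  The rung of [c] sees the vertices whose colour has at least the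
    rank of [c], so that the neighbourhoods of the rungs in [W] form a strictly
    decreasing chain.  The rungs form a clique to keep their degrees above 1. *)
Definition frame_adj (k : W -> C) (u v : W + (C + bool)) : bool :=
  match u, v with
  | inl w, inl w' => e w w'
  | inl w, inr (inl c) | inr (inl c), inl w => (enum_rank c <= enum_rank (k w))%N
  | inl _, inr (inr b) | inr (inr b), inl _ => b
  | inr (inl c), inr (inl c') => c != c'
  | inr (inr b), inr (inr b') => b != b'
  | _, _ => false
  end.

Fact frame_adj_sym k : symmetric (frame_adj k).
Proof. by move=> [w|[c|b]] [w'|[c'|b']] //=; rewrite eq_sym. Qed.

Fact frame_adj_irrefl k : irreflexive (frame_adj k).
Proof. by move=> [w|[c|b]] //=; rewrite eqxx. Qed.

Definition frame k : sgraph := SGraph (@frame_adj_sym k) (@frame_adj_irrefl k).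

Notation apex := (inr (inr true) : W + (C + bool)).
Notation leaf := (inr (inr false) : W + (C + bool)).
Notation rung c := (inr (inl c) : W + (C + bool)).

Lemma frame_connected k : (forall c, exists w, k w = c) -> connected_graph (frame k).
Proof.
move=> k_onto; split; first by apply/card_gt0P; exists apex.
have to_apex x : connect (@adj (frame k)) x apex.
  case: x => [w|[c|[]]]; try exact: connect1; last by [].
  have [w kw] := k_onto c.
  apply: (@connect_trans _ _ (inl w)); apply: connect1 => //=.
  by rewrite kw.
move=> x y; apply: connect_trans (to_apex x) _.
by rewrite (sym_connect_sym (@adj_sym (frame k))).
Qed.

(** The leaf is the only vertex of degree at most 1, which is the first step in
    recognising the skeleton. *)
Lemma leafP k v : (forall c, exists w, k w = c) ->
  reflect (forall a b, frame_adj k v a -> frame_adj k v b -> a = b) (v == leaf).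
Proof.
move=> k_onto; apply: (iffP eqP) => [->|uniq_nbr].
  by move=> [w|[c|[]]] [w'|[c'|[]]].
have third (c : C) : exists c1 c2, [/\ c1 != c2, c != c1 & c != c2].
  move: C_big; rewrite (cardD1 c) inE ltnS => /card_gt1P[c1 [c2 []]].
  by rewrite !inE !andbT ![_ == c]eq_sym => h1 h2 h12; exists c1, c2.
case: v uniq_nbr => [w|[c|[]]] // uniq_nbr.
- by have := uniq_nbr apex (rung (k w)); rewrite /= leqnn => /(_ isT isT).
- have [c1 [c2 [c12 cc1 cc2]]] := third c.
  by have [] := uniq_nbr (rung c1) (rung c2) cc1 cc2; move/eqP: c12.
- have [c _] : exists c : C, true.
    by move: C_big; case: (pickP (mem C)) => [c|/eq_card0->] // _; exists c.
  have [w _] := k_onto c.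
  by have := uniq_nbr (inl w) leaf isT isT.
Qed.

(** An isomorphism fixes the leaf, hence its neighbour the apex, and hence maps the
    neighbourhood [W] of the apex to itself and rungs to rungs.  The rungs see
    different numbers of vertices of [W], so each is fixed; and the colour of [w] is
    the greatest one whose rung sees [w].  The numbers are compared between the two
    graphs, so their colour classes must have equal sizes. *)
Lemma frame_iso (k k' : W -> C) (phi : frame k -> frame k') :
  (forall c, exists w, k w = c) -> (forall c, exists w, k' w = c) ->
  (forall c : C, #|[pred w | (enum_rank c <= enum_rank (k w))%N]| =
             #|[pred w | (enum_rank c <= enum_rank (k' w))%N]|) ->
  bijective phi -> (forall x y, adj (phi x) (phi y) = adj x y) ->
  exists s : W -> W, [/\ injective s, forall w, phi (inl w) = inl (s w),
    forall x, phi (inr x) = inr x, forall w w', e (s w) (s w') = e w w' &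
    forall w, k' (s w) = k w].
Proof.
move=> k_onto k'_onto levels [psi phiK psiK] phi_adj.
have {}phi_adj x y : frame_adj k' (phi x) (phi y) = frame_adj k x y.
  exact: phi_adj.
have phi_inj : injective phi by exact: can_inj phiK.
have phi_leaf : phi leaf = leaf.
  apply/eqP/(leafP _ k'_onto) => a b; rewrite -(psiK a) -(psiK b) !phi_adj.
  by move=> ha hb; congr (phi _); apply: (elimT (leafP leaf k_onto)) ha hb.
have phi_apex : phi apex = apex.
  have := phi_adj leaf apex; rewrite phi_leaf.
  by case: (phi apex) => [?|[?|[]]].
have phi_base w : exists w', phi (inl w) = inl w'.
  have := phi_adj apex (inl w); rewrite phi_apex.
  case E: (phi (inl w)) => [w'|[c'|[]]] //; first by exists w'.
  by move: E; rewrite -phi_leaf => /phi_inj.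
have phi_rung c : exists c', phi (rung c) = rung c'.
  have := phi_adj apex (rung c); rewrite phi_apex.
  case E: (phi (rung c)) => [w'|[c'|[]]] //; first by exists c'.
  by move: E; rewrite -phi_apex => /phi_inj.
have [s phi_s] := choice phi_base; have [t phi_t] := choice phi_rung.
have s_inj : injective s.
  move=> w w' ss; have : phi (inl w) = phi (inl w') by rewrite !phi_s ss.
  by move/phi_inj => [].
have s_e w w' : e (s w) (s w') = e w w'.
  by have := phi_adj (inl w) (inl w'); rewrite !phi_s.
have s_rung c w : (enum_rank (t c) <= enum_rank (k' (s w)))%N =
                  (enum_rank c <= enum_rank (k w))%N.
  by have := phi_adj (rung c) (inl w); rewrite phi_s phi_t.
pose level (f : W -> C) (c : C) := #|[pred w | (enum_rank c <= enum_rank (f w))%N]|.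
have level_lt f (c d : C) : (forall c, exists w, f w = c) ->
    (enum_rank c < enum_rank d)%N -> (level f d < level f c)%N.
  move=> f_onto cd; apply/proper_card/properP; split.
    by apply/fintype.subsetP => w; rewrite !inE; apply: leq_trans (ltnW cd).
  by have [w fw] := f_onto c; exists w; rewrite !inE fw // -ltnNge.
have level_inj (f : W -> C) : (forall c, exists w, f w = c) -> injective (level f).
  move=> f_onto c d ll.
  case: (ltngtP (enum_rank c) (enum_rank d)) => [cd|dc|/val_inj/enum_rank_inj//].
    by have := level_lt f c d f_onto cd; rewrite ll ltnn.
  by have := level_lt f d c f_onto dc; rewrite ll ltnn.
have t_id c : t c = c.
  apply: (level_inj k' k'_onto); rewrite -[RHS]levels -[RHS](card_image s_inj).
  have [s' _ sK] : bijective s by exact: injF_bij.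
  by apply: eq_card => w; rewrite -(sK w) (fintype.mem_image s_inj) !inE s_rung.
exists s; split=> // [[c|[]]|w] //; first by rewrite phi_t t_id.
apply: enum_rank_inj; apply: val_inj; apply/eqP; rewrite eqn_leq.
by rewrite -(s_rung (k' (s w)) w) t_id leqnn /= -{1}(t_id (k w)) s_rung leqnn.
Qed.

Section FrameQuantum.
Variables (R : realType) (A : cstarAlgType R) (k k' : W -> C) (U : W -> W -> A).
Hypothesis U_proj : forall v w, projection (U v w).
Hypothesis U_row : forall v, \sum_w U v w = 1.
Hypothesis U_col : forall w, \sum_v U v w = 1.
Hypothesis U_adj : forall v w, \sum_(v' | e v v') U v' w = \sum_(w' | e w' w) U v w'.
Hypothesis U_colour : forall v w, k v != k' w -> U v w = 0.

Definition frame_mx (x y : W + (C + bool)) : A :=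
  match x, y with
  | inl v, inl w => U v w
  | inr c, inr d => (c == d)%:R
  | _, _ => 0
  end.

(** At a rung the intertwining relation says that the sum of row [v] over the
    columns of rank at least [c] is 1 or 0 according to the rank of [k v], which
    holds because [U] respects colours. *)
Lemma frame_quantum_iso : quantum_iso R (frame k) (frame k').
Proof.
apply: (@quantum_iso_of_fun _ _ _ _ (frame_mx : frame k -> frame k' -> A)).
- move=> [v|c] [w|d] /=; [exact: U_proj | exact: (projection_nat A false)
    | exact: (projection_nat A false) | exact: projection_nat].
- case=> [v|c]; rewrite big_sumType /=.
    by rewrite U_row big1 ?addr0.
  rewrite big1 // add0r (bigD1 c) //= eqxx big1 ?addr0 // => d dc.
  by rewrite eq_sym (negPf dc).
- case=> [w|d]; rewrite big_sumType /=.
    by rewrite U_col big1 ?addr0.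
  rewrite big1 // add0r (bigD1 d) //= eqxx big1 ?addr0 // => c cd.
  by rewrite (negPf cd).
have U_rung v (c : C) : \sum_(w | (enum_rank c <= enum_rank (k' w))%N) U v w =
    ((enum_rank c <= enum_rank (k v))%N)%:R.
  rewrite big_mkcond /=.
  transitivity (\sum_w ((enum_rank c <= enum_rank (k v))%N)%:R * U v w).
    apply: eq_bigr => w _; have [->|kk'] := eqVneq (k v) (k' w).
      by case: ifP; rewrite ?mul1r ?mul0r.
    by rewrite U_colour // mulr0 if_same.
  by rewrite -mulr_sumr U_row mulr1.
have U_rung' w (c : C) : \sum_(v | (enum_rank c <= enum_rank (k v))%N) U v w =
    ((enum_rank c <= enum_rank (k' w))%N)%:R.
  rewrite big_mkcond /=.
  transitivity (\sum_v ((enum_rank c <= enum_rank (k' w))%N)%:R * U v w).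
    apply: eq_bigr => v _; have [->|kk'] := eqVneq (k v) (k' w).
      by case: ifP; rewrite ?mul1r ?mul0r.
    by rewrite U_colour // mulr0 if_same.
  by rewrite -mulr_sumr U_col mulr1.
have sum_deltal (P : pred (C + bool)) d : \sum_(c | P c) (c == d)%:R = (P d)%:R :> A.
  rewrite big_mkcond (bigD1 d) //= eqxx big1 => [|c /negPf->]; last by rewrite if_same.
  by rewrite addr0; case: (P d).
have sum_deltar (P : pred (C + bool)) d : \sum_(c | P c) (d == c)%:R = (P d)%:R :> A.
  by rewrite -sum_deltal; apply: eq_bigr => c _; rewrite eq_sym.
case=> [v|c] [w|d]; rewrite big_sumType [RHS]big_sumType /=.
- by rewrite U_adj [X in _ + X]big1 // [X in _ = _ + X]big1.
- rewrite big1 // add0r [X in _ = _ + X]big1 // addr0.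
  rewrite (sum_deltal (fun c => frame_adj k (inl v) (inr c))).
  case: d => [d|[]] /=; first by rewrite U_rung.
    by rewrite -(U_row v).
  by rewrite big_pred0.
- rewrite [X in _ + X]big1 // addr0 [X in _ = X + _]big1 // add0r.
  rewrite (sum_deltar (fun d => frame_adj k' (inr d) (inl w))).
  case: c => [c|[]] /=; first by rewrite U_rung'.
    by rewrite -(U_col w).
  by rewrite big_pred0.
- rewrite big1 // add0r [X in _ = X + _]big1 // add0r.
  rewrite (sum_deltal (fun x => frame_adj k (inr c) (inr x))).
  by rewrite (sum_deltar (fun x => frame_adj k' (inr x) (inr d))).
Qed.

End FrameQuantum.
End Frame.

(** * Graphs of parity equations *)

Section System.
Variables (I Q : finType) (c0 c1 c2 : Q -> I).
Hypothesis c01 : forall q, c0 q != c1 q.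
Hypothesis c02 : forall q, c0 q != c2 q.
Hypothesis c12 : forall q, c1 q != c2 q.

Notation node := (I * bool + Q * (bool * bool))%type.

(** A context vertex [(q, ab)] stands for the assignment of [ab.1], [ab.2] and
    [ab.1 (+) ab.2] to the three unknowns of equation [q]. *)
Definition agrees (v : I * bool) (q : Q) (ab : bool * bool) :=
  [|| (c0 q, ab.1) == v, (c1 q, ab.2) == v | (c2 q, ab.1 (+) ab.2) == v].

Definition sys_adj (u v : node) :=
  match u, v with
  | inl x, inr (q, ab) | inr (q, ab), inl x => agrees x q ab
  | _, _ => false
  end.

Lemma sys_adj_sym : symmetric sys_adj.
Proof. by move=> [x|[q ab]] [y|[r ac]]. Qed.

Lemma sys_adj_irrefl : irreflexive sys_adj.
Proof. by move=> [x|[q ab]]. Qed.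

Lemma agrees0 q a ab : agrees (c0 q, a) q ab = (ab.1 == a).
Proof.
rewrite /agrees !xpair_eqE eqxx /= ![_ == c0 q]eq_sym (negPf (c01 q)) (negPf (c02 q)).
by rewrite !orbF.
Qed.

Lemma agrees1 q a ab : agrees (c1 q, a) q ab = (ab.2 == a).
Proof.
rewrite /agrees !xpair_eqE eqxx /= (negPf (c01 q)) ![_ == c1 q]eq_sym (negPf (c12 q)).
by rewrite /= orbF.
Qed.

Lemma agrees2 q a ab : agrees (c2 q, a) q ab = (ab.1 (+) ab.2 == a).
Proof.
by rewrite /agrees !xpair_eqE eqxx /= (negPf (c02 q)) (negPf (c12 q)).
Qed.

Lemma agreesN i q a ab : i \notin [:: c0 q; c1 q; c2 q] -> agrees (i, a) q ab = false.
Proof.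
rewrite !inE !negb_or ![i == _]eq_sym /agrees !xpair_eqE.
by case/and3P => /negPf-> /negPf-> /negPf->.
Qed.

Variable j : I.
Hypothesis I_big : (1 < #|I|)%N.

(** The classes are the unknowns and the equations, except that the value [b] of
    the unknown [j] has a colour of its own. *)
Definition colour (b : bool) (v : node) : option (I + Q) :=
  match v with
  | inl (i, a) => if (i == j) && (a == b) then None else Some (inl i)
  | inr (q, _) => Some (inr q)
  end.

Lemma colour_onto b c : exists v, colour b v = c.
Proof.
case: c => [[i|q]|].
- by exists (inl (i, ~~ b)); rewrite /=; case: b; rewrite andbF.
- by exists (inr (q, (false, false))).
- by exists (inl (j, b)); rewrite /= !eqxx.
Qed.

Lemma colour_big : (2 < #|{: option (I + Q)}|)%N.
Proof.
by rewrite card_option card_sum ltnS (leq_trans I_big) ?leq_addr.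
Qed.

Definition flip_node (v : node) : node :=
  match v with inl (i, a) => inl (i, ~~ a) | inr _ => v end.

Lemma flip_nodeK : involutive flip_node.
Proof. by move=> [[i a]|x] //=; rewrite negbK. Qed.

Lemma colour_flip b b' v : colour b v = colour b' (if b == b' then v else flip_node v).
Proof. by case: b b' => [] []; case: v => [[i []]|[q ab]]. Qed.

(** Flipping all the values exchanges the two markings. *)
Lemma colour_levels b b' (P : pred (option (I + Q))) :
  #|[pred v | P (colour b v)]| = #|[pred v | P (colour b' v)]|.
Proof.
have [->//|bb'] := eqVneq b b'.
rewrite -(card_image (inv_inj flip_nodeK) [pred v | P (colour b v)]).
apply: eq_card => v; rewrite -{1}(flip_nodeK v).
rewrite (fintype.mem_image (inv_inj flip_nodeK)) !inE.
by rewrite (colour_flip b b') (negPf bb') flip_nodeK.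
Qed.

Definition sys_graph b := frame sys_adj_sym sys_adj_irrefl (colour b).

(** This gives at once the rigidity of each graph and, at [j], the difference between
    the two. *)
Hypothesis classical : forall f : I -> bool,
  (forall q, f (c2 q) = f (c0 q) (+) f (c1 q)) -> forall i, f i = false.

(** Within its class, [(i, a)] can only move to [(i, a (+) f i)].  Following the edges
    from a context vertex to its three values shows that [f] satisfies the
    equations; and if [b] and [b'] differ, then [f j] is 1. *)
Lemma sys_iso b b' (s : node -> node) :
  injective s -> (forall v w, sys_adj (s v) (s w) = sys_adj v w) ->
  (forall v, colour b' (s v) = colour b v) -> s =1 id /\ b = b'.
Proof.
move=> s_inj s_adj s_col.
have s_var i a : exists a', s (inl (i, a)) = inl (i, a').
  have := s_col (inl (i, a)) => /=; case: (s (inl (i, a))) => [[i' a']|[q ab]] /=.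
    do 2?case: ifP; rewrite ?andbT //.
      by move=> /andP[/eqP-> _] /andP[/eqP-> _] _; exists a'.
    by move=> _ _ [->]; exists a'.
  by case: ifP.
have s_eqn q ab : exists ab', s (inr (q, ab)) = inr (q, ab').
  have := s_col (inr (q, ab)) => /=; case: (s (inr (q, ab))) => [[i' a']|[r ab']] /=.
    by case: ifP.
  by case=> ->; exists ab'.
pose f i := if s (inl (i, false)) is inl (_, a) then a else false.
have sE i a : s (inl (i, a)) = inl (i, a (+) f i).
  have [a0 E0] := s_var i false; have [a1 E1] := s_var i true.
  have : a0 != a1.
    by apply/eqP => a01; have := s_inj (inl (i, false)) (inl (i, true));
       rewrite E0 E1 a01 => /(_ erefl).
  by rewrite /f E0; case: a; rewrite ?E0 ?E1; move: a0 a1 {E0 E1} => [] [].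
have s_eqnE q ab : [/\ s (inr (q, ab)) = inr (q, (ab.1 (+) f (c0 q), ab.2 (+) f (c1 q)))
    & f (c2 q) = f (c0 q) (+) f (c1 q)].
  have [[a' b''] E] := s_eqn q ab.
  have := s_adj (inl (c0 q, ab.1)) (inr (q, ab)).
  have := s_adj (inl (c1 q, ab.2)) (inr (q, ab)).
  have := s_adj (inl (c2 q, ab.1 (+) ab.2)) (inr (q, ab)).
  rewrite !sE E /= !agrees0 !agrees1 !agrees2 !eqxx /= => h2 /eqP hb /eqP ha.
  move: h2; rewrite {}ha {}hb /=.
  by case: (ab.1) (ab.2) (f (c0 q)) (f (c1 q)) (f (c2 q)) => [] [] [] [] [].
have f0 := classical (fun q => proj2 (s_eqnE q (false, false))).
have s_id : s =1 id.
  case=> [[i a]|[q [a a']]]; first by rewrite sE f0 addbF.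
  by have [-> _] := s_eqnE q (a, a'); rewrite !f0 !addbF.
split=> //; have := s_col (inl (j, b)); rewrite s_id /= !eqxx /=.
by case: eqP.
Qed.

Lemma sys_graph_iso b b' (phi : sys_graph b -> sys_graph b') :
  bijective phi -> (forall x y, adj (phi x) (phi y) = adj x y) ->
  phi =1 id /\ b = b'.
Proof.
move=> phi_bij phi_adj.
have levels (c : option (I + Q)) :=
  colour_levels b b' (fun d => (enum_rank c <= enum_rank d)%N).
have [s [s_inj phi_l phi_r s_adj s_col]] :=
  frame_iso colour_big (colour_onto b) (colour_onto b') levels phi_bij phi_adj.
have [s_id bb'] := sys_iso s_inj s_adj s_col; split=> // -[v|c] //.
by rewrite phi_l s_id.
Qed.

Lemma sys_graph_connected b : connected_graph (sys_graph b).
Proof. exact/frame_connected/colour_onto. Qed.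

Lemma sys_graph_asymmetric b : asymmetric (sys_graph b).
Proof.
apply/eqP; rewrite finset.eqEsubset sub1G andbT; apply/fintype.subsetP => s.
rewrite !inE => /forallP s_aut; apply/eqP/permP => x; rewrite perm1.
have [|s_id _] := @sys_graph_iso b b s (injF_bij (@perm_inj _ s)).
  by move=> y z; have /forallP/(_ z)/eqP := s_aut y.
exact: s_id.
Qed.

Lemma sys_graphs_not_iso : ~ graph_iso (sys_graph false) (sys_graph true).
Proof. by case=> phi phi_bij /(sys_graph_iso phi_bij)[]. Qed.

End System.

(** * The magic unitary of an operator solution *)

Section QuantumSolution.
Variables (R : realType) (A : cstarAlgType R).
Variables (I Q : finType) (c0 c1 c2 : Q -> I) (j : I).
Hypothesis c01 : forall q, c0 q != c1 q.
Hypothesis c02 : forall q, c0 q != c2 q.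
Hypothesis c12 : forall q, c1 q != c2 q.
Variable rho : I -> A.
Hypothesis rho_star : forall i, star (rho i) = rho i.
Hypothesis rho_sqr : forall i, rho i * rho i = 1.
Hypothesis rho_eqn : forall q, rho (c0 q) * rho (c1 q) = rho (c2 q).
Hypothesis rho_j : rho j = -1.

Definition spectral_proj i (s : bool) : A := 2^-1 *: (1 + (-1) ^+ s *: rho i).

Lemma half_double (x : A) : (2^-1 : R[i]) *: (x + x) = x.
Proof. by rewrite -mulr2n -[x *+ 2]scaler_nat scalerA mulVf ?scale1r // pnatr_eq0. Qed.

Lemma spectral_projP i s : projection (spectral_proj i s).
Proof.
split; rewrite /spectral_proj.
  rewrite starZ starD star1 starZ rho_star rmorphXn rmorphN rmorph1.
  by rewrite fmorphV rmorph_nat.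
rewrite expr2 -scalerAl -scalerAr scalerA mulrDl mul1r mulrDr mulr1.
rewrite -scalerAl -scalerAr rho_sqr scalerA -signr_addb addbb expr0 scale1r.
by rewrite [_ *: rho i + 1]addrC -scalerA half_double.
Qed.

(** A product of two self-adjoint elements is self-adjoint only if they commute. *)
Lemma rho_comm q : rho (c1 q) * rho (c0 q) = rho (c0 q) * rho (c1 q).
Proof. by rewrite rho_eqn -[RHS]rho_star -rho_eqn starM !rho_star. Qed.

Lemma spectral_proj_comm q s t : spectral_proj (c0 q) s * spectral_proj (c1 q) t =
  spectral_proj (c1 q) t * spectral_proj (c0 q) s.
Proof.
rewrite /spectral_proj -!scalerAl -!scalerAr; congr (_ *: (_ *: _)).
rewrite !(mulrDl, mulrDr, mul1r, mulr1) -!scalerAl -!scalerAr rho_comm.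
by rewrite (scalerA _ _ (_ * _)) mulrC -scalerA -!addrA; congr (_ + _); rewrite addrCA.
Qed.

Lemma spectral_proj_sum i s : spectral_proj i s + spectral_proj i (~~ s) = 1.
Proof.
rewrite /spectral_proj -scalerDr addrACA -scalerDl signrN subrr scale0r addr0.
by rewrite half_double.
Qed.

Lemma spectral_proj_xor q s t :
  spectral_proj (c0 q) s * spectral_proj (c1 q) t +
  spectral_proj (c0 q) (~~ s) * spectral_proj (c1 q) (~~ t) =
  spectral_proj (c2 q) (s (+) t).
Proof.
rewrite /spectral_proj -!scalerAl -!scalerAr -!scalerDr; congr (_ *: _).
rewrite !(mulrDl, mulrDr, mul1r, mulr1) -!scalerAl -!scalerAr !scalerA !rho_eqn.
rewrite -!signr_addb addNb addbN negbK -!addrA.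
rewrite !signrN !scaleNr -[RHS]half_double; congr (_ *: _); rewrite !addrA.
by rewrite [LHS](ACl ((1*4*5*8)*(2*6)*(3*7)))%AC /= !subrr !addr0.
Qed.

Definition context_proj q (ab ab' : bool * bool) : A :=
  spectral_proj (c0 q) (ab.1 (+) ab'.1) * spectral_proj (c1 q) (ab.2 (+) ab'.2).

Lemma context_projP q ab ab' : projection (context_proj q ab ab').
Proof.
have [s0 p0] := spectral_projP (c0 q) (ab.1 (+) ab'.1).
have [s1 p1] := spectral_projP (c1 q) (ab.2 (+) ab'.2).
rewrite /context_proj; split; first by rewrite starM -s0 -s1 spectral_proj_comm.
rewrite expr2 {3}spectral_proj_comm mulrA -[_ * _ * spectral_proj (c1 q) _]mulrA.
by rewrite -expr2 -p1 -mulrA -spectral_proj_comm mulrA -expr2 -p0.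
Qed.

Lemma sum_pair (F : bool * bool -> A) :
  \sum_ab F ab =
    F (true, true) + F (true, false) + (F (false, true) + F (false, false)).
Proof.
rewrite (eq_bigr (fun ab => F (ab.1, ab.2))) => [|[] //].
by rewrite -(pair_bigA _ (fun a b => F (a, b))) /= !big_bool.
Qed.

Lemma context_proj_sum q ab : \sum_ab' context_proj q ab ab' = 1.
Proof.
rewrite sum_pair /context_proj -!mulrDr /= !addbF !addbT.
rewrite (addrC _ (spectral_proj (c1 q) ab.2)) spectral_proj_sum !mulr1.
by rewrite addrC spectral_proj_sum.
Qed.

(** The three unknowns of a context give the same relation, since its projections
    are labelled by the joint spectrum of all three: summing over the assignments
    with a given value at one of them leaves the spectral projection of that one. *)
Lemma context_proj_agrees q i a ab :
  \sum_(ab' | agrees c0 c1 c2 (i, a) q ab') context_proj q ab' ab =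
  \sum_(a' | agrees c0 c1 c2 (i, a') q ab) spectral_proj i (a (+) a').
Proof.
have [|iq] := boolP (i \in [:: c0 q; c1 q; c2 q]); last first.
  by rewrite !big_pred0 // => x; apply: agreesN.
have sum0 x : (spectral_proj (c0 q) true * x + spectral_proj (c0 q) false * x = x) *
              (spectral_proj (c0 q) false * x + spectral_proj (c0 q) true * x = x).
  by rewrite -!mulrDl (spectral_proj_sum _ true) (spectral_proj_sum _ false) mul1r.
have sum1 x : (x * spectral_proj (c1 q) true + x * spectral_proj (c1 q) false = x) *
              (x * spectral_proj (c1 q) false + x * spectral_proj (c1 q) true = x).
  by rewrite -!mulrDr (spectral_proj_sum _ true) (spectral_proj_sum _ false) mulr1.
have xorE := (spectral_proj_xor q true true, spectral_proj_xor q true false,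
  spectral_proj_xor q false true, spectral_proj_xor q false false).
rewrite big_mkcond [RHS]big_mkcond /= big_bool sum_pair /context_proj.
rewrite !inE => /or3P[] /eqP->;
  rewrite ?(agrees0 c01 c02) ?(agrees1 c01 c12) ?(agrees2 c02 c12).
- by case: ab a => [[] []] [] /=; rewrite ?addr0 ?add0r ?sum1.
- by case: ab a => [[] []] [] /=; rewrite ?addr0 ?add0r ?sum0.
- by case: ab a => [[] []] [] /=; rewrite ?addr0 ?add0r ?xorE.
Qed.

Lemma context_projC q ab ab' : context_proj q ab ab' = context_proj q ab' ab.
Proof. by rewrite /context_proj addbC [_.2 (+) _]addbC. Qed.

(** The entry between two vertices of a class depends only on the shift from the one
    to the other. *)
Definition sys_mx (v w : I * bool + Q * (bool * bool)) : A :=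
  match v, w with
  | inl (i, a), inl (i', a') => if i == i' then spectral_proj i (a (+) a') else 0
  | inr (q, ab), inr (q', ab') => if q == q' then context_proj q ab ab' else 0
  | _, _ => 0
  end.

Lemma sys_mxC v w : sys_mx v w = sys_mx w v.
Proof.
case: v w => [[i a]|[q ab]] [[i' a']|[q' ab']] //=; rewrite eq_sym.
  by case: eqP => [->|]//; rewrite addbC.
by case: eqP => [->|]//; rewrite context_projC.
Qed.

Lemma sys_mx_sum v : \sum_w sys_mx v w = 1.
Proof.
rewrite big_sumType; case: v => [[i a]|[q ab]] /=.
  rewrite [X in _ + X]big1 // addr0.
  rewrite (eq_bigr (fun w => sys_mx (inl (i, a)) (inl (w.1, w.2)))) => [|[] //].
  rewrite -(pair_bigA _ (fun i' a' => sys_mx (inl (i, a)) (inl (i', a')))) /=.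
  rewrite (bigD1 i) //= eqxx [X in _ + X]big1 => [|i' ii']; last first.
    by rewrite big1 // => a' _; rewrite eq_sym (negPf ii').
  by rewrite addr0 big_bool /= addbT addbF addrC spectral_proj_sum.
rewrite big1 ?add0r //.
rewrite (eq_bigr (fun w => sys_mx (inr (q, ab)) (inr (w.1, w.2)))) => [|[] //].
rewrite -(pair_bigA _ (fun q' ab' => sys_mx (inr (q, ab)) (inr (q', ab')))) /=.
rewrite (bigD1 q) //= eqxx [X in _ + X]big1 => [|q' qq']; last first.
  by rewrite big1 // => ab' _; rewrite eq_sym (negPf qq').
by rewrite addr0 context_proj_sum.
Qed.

Lemma sys_mx_agrees i a q ab :
  \sum_(v | sys_adj c0 c1 c2 (inl (i, a)) v) sys_mx v (inr (q, ab)) =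
  \sum_(v | sys_adj c0 c1 c2 v (inr (q, ab))) sys_mx (inl (i, a)) v.
Proof.
rewrite big_sumType [RHS]big_sumType /= big_pred0 // add0r.
rewrite [X in _ = _ + X]big_pred0 ?addr0; last by case.
transitivity (\sum_(ab' | agrees c0 c1 c2 (i, a) q ab') context_proj q ab' ab).
  rewrite big_mkcond [RHS]big_mkcond /=.
  rewrite (eq_bigr (fun w => if agrees c0 c1 c2 (i, a) w.1 w.2
    then sys_mx (inr (w.1, w.2)) (inr (q, ab)) else 0)) => [|[] //].
  rewrite -(pair_bigA _ (fun q' ab' => if agrees c0 c1 c2 (i, a) q' ab'
    then sys_mx (inr (q', ab')) (inr (q, ab)) else 0)) /=.
  rewrite (bigD1 q) //= [X in _ + X]big1 => [|q' /negPf qq'].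
    by rewrite addr0 eqxx.
  by rewrite big1 // => ab' _; rewrite qq' if_same.
rewrite context_proj_agrees big_mkcond [RHS]big_mkcond /=.
rewrite [RHS](eq_bigr (fun w => if agrees c0 c1 c2 (w.1, w.2) q ab
    then sys_mx (inl (i, a)) (inl (w.1, w.2)) else 0)) => [|[] //].
rewrite -(pair_bigA _ (fun i' a' => if agrees c0 c1 c2 (i', a') q ab
    then sys_mx (inl (i, a)) (inl (i', a')) else 0)) /=.
rewrite (bigD1 i) //= [X in _ + X]big1 => [|i' ii'].
  by rewrite addr0 eqxx.
by rewrite big1 // => a' _; rewrite eq_sym (negPf ii') if_same.
Qed.

Lemma sys_mx_adj v w :
  \sum_(v' | sys_adj c0 c1 c2 v v') sys_mx v' w =
  \sum_(w' | sys_adj c0 c1 c2 w' w) sys_mx v w'.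
Proof.
case: v w => [[i a]|[q ab]] [[i' a']|[q' ab']].
- by rewrite big1 ?big1 => [//|[[? ?]|[? ?]] //=|[[? ?]|[? ?]] //=].
- exact: sys_mx_agrees.
- have := sys_mx_agrees i' a' q ab => /esym E.
  under eq_bigr do rewrite sys_mxC; under [RHS]eq_bigr do rewrite sys_mxC.
  under eq_bigl do rewrite sys_adj_sym; under [RHS]eq_bigl do rewrite sys_adj_sym.
  exact: E.
- by rewrite big1 ?big1 => [//|[[? ?]|[? ?]] //=|[[? ?]|[? ?]] //=].
Qed.

(** As [rho j] is the scalar -1, [spectral_proj j false] is 0 and
    [spectral_proj j true] is 1.  Thus the value of [j] always flips, which carries
    the marking of [false] to that of [true]. *)
Lemma sys_mx_colour v w : colour j false v != colour j true w -> sys_mx v w = 0.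
Proof.
case: v w => [[i a]|[q ab]] [[i' a']|[q' ab']] //=; last first.
  by case: (eqVneq q q') => [->|//]; rewrite eqxx.
case: (eqVneq i i') => [<-|//]; have [->|_] /= := eqVneq i j; last by rewrite eqxx.
move=> aa'; have -> : a (+) a' = false by case: a a' aa' => [] []; rewrite /= ?eqxx.
by rewrite /spectral_proj rho_j expr0 scale1r subrr scaler0.
Qed.

Theorem sys_graph_quantum_iso :
  quantum_iso R (sys_graph c0 c1 c2 j false) (sys_graph c0 c1 c2 j true).
Proof.
apply: (frame_quantum_iso _ _ (U := sys_mx)) => //.
- move=> v w; case: v w => [[i a]|[q ab]] [[i' a']|[q' ab']] //=;
    try exact: (projection_nat A false).
    by case: eqP => _; [exact: spectral_projP | exact: (projection_nat A false)].
  by case: eqP => _; [exact: context_projP | exact: (projection_nat A false)].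
- exact: sys_mx_sum.
- by move=> w; under eq_bigr do rewrite sys_mxC; exact: sys_mx_sum.
- exact: sys_mx_adj.
- exact: sys_mx_colour.
Qed.

End QuantumSolution.

(** * The C*-algebra of complex matrices *)

Section DotProduct.
Variables (C : numClosedFieldType) (n : nat).
Implicit Types u v w : 'rV[C]_n.

Local Notation "''[' u , v ]" := (dotmx u v) : ring_scope.

Lemma dotE u v : '[u, v] = \sum_i u 0 i * (v 0 i)^*.
Proof. by rewrite dotmxE mxE; apply: eq_bigr => i _; rewrite !mxE. Qed.

Lemma dotC u v : '[v, u] = '[u, v]^*.
Proof.
rewrite !dotE rmorph_sum /=; apply: eq_bigr => i _.
by rewrite rmorphM /= conjCK mulrC.
Qed.

Lemma dotD u v w : '[u + v, w] = '[u, w] + '[v, w].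
Proof.
by rewrite !dotE -big_split; apply: eq_bigr => i _; rewrite mxE mulrDl.
Qed.

Lemma dotZ a u v : '[a *: u, v] = a * '[u, v].
Proof. by rewrite !dotE mulr_sumr; apply: eq_bigr => i _; rewrite mxE mulrA. Qed.

Lemma dotDr w u v : '[w, u + v] = '[w, u] + '[w, v].
Proof.
by rewrite !dotE -big_split; apply: eq_bigr => i _; rewrite mxE rmorphD mulrDr.
Qed.

Lemma dotZr a u v : '[v, a *: u] = a^* * '[v, u].
Proof.
by rewrite !dotE mulr_sumr; apply: eq_bigr => i _; rewrite mxE rmorphM mulrCA.
Qed.

Lemma dot_adj (x : 'M[C]_n) u v : '[u *m x, v] = '[u, v *m (x ^t*)].
Proof. by rewrite !dotmxE trmx_mul map_mxM trmxCK mulmxA. Qed.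

Lemma dot_ge0 u : 0 <= '[u, u].
Proof. exact: dnorm_ge0. Qed.

Lemma dot_eq0 u : ('[u, u] == 0) = (u == 0).
Proof. exact: dnorm_eq0. Qed.

(** The square norm of [N u - <u, v> v], where [N] is the square norm of [v], is [N]
    times the difference of the two sides. *)
Lemma cauchy_schwarz u v : `|'[u, v]| ^+ 2 <= '[u, u] * '[v, v].
Proof.
have [->|v0] := eqVneq v 0.
  have -> : 0 = 0 *: 0 :> 'rV[C]_n by rewrite scale0r.
  by rewrite !dotZr rmorph0 !mul0r normr0 expr0n mulr0.
have nv : 0 < '[v, v] by rewrite lt_def dot_eq0 v0 dot_ge0.
have := dot_ge0 ('[v, v] *: u + (- '[u, v]) *: v).
have -> : '['[v, v] *: u + (- '[u, v]) *: v, '[v, v] *: u + (- '[u, v]) *: v] =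
          '[v, v] * ('[u, u] * '[v, v] - `|'[u, v]| ^+ 2).
  rewrite !(dotD, dotDr, dotZ, dotZr) -(dotC v v) (dotC u v) normCK rmorphN.
  by move: ('[u, v]) ('[u, v]^*) ('[u, u]) ('[v, v]) => c c' U N /=; ring.
by rewrite pmulr_rge0 // subr_ge0.
Qed.

End DotProduct.

Section ComplexNorm.
Variables (R : realType) (n : nat).
Local Notation C := R[i].
Implicit Types u v w : 'rV[C]_n.

Lemma normc_ge0 (a : C) : 0 <= normc a.
Proof. by case: a => x y; rewrite sqrtr_ge0. Qed.

Definition l2norm v : R := Num.sqrt (\sum_i normc (v 0 i) ^+ 2).

Lemma l2_ge0 v : 0 <= l2norm v. Proof. exact: sqrtr_ge0. Qed.

Lemma l2_sqr v : l2norm v ^+ 2 = \sum_i normc (v 0 i) ^+ 2.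
Proof. by rewrite sqr_sqrtr // sumr_ge0 // => i _; rewrite sqr_ge0. Qed.

Lemma dot_l2 v : dotmx v v = (l2norm v ^+ 2)%:C%C.
Proof.
rewrite l2_sqr dotE (rmorph_sum (real_complex R)); apply: eq_bigr => i _.
by rewrite (rmorphXn (real_complex R)) -normCK.
Qed.

Lemma normc_dot_le v w : normc (dotmx v w) <= l2norm v * l2norm w.
Proof.
rewrite -ler_sqr ?nnegrE ?mulr_ge0 ?l2_ge0 ?normc_ge0 // exprMn.
have : (normc (dotmx v w))%:C%C ^+ 2 <= dotmx v v * dotmx w w.
  exact: cauchy_schwarz.
rewrite !dot_l2 -(rmorphM (real_complex R)) -(rmorphXn (real_complex R)).
by rewrite lecR.
Qed.

Lemma normc_le_l2 v i : normc (v 0 i) <= l2norm v.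
Proof.
rewrite -ler_sqr ?nnegrE ?l2_ge0 ?normc_ge0 // l2_sqr (bigD1 i) //= lerDl.
by apply: sumr_ge0 => j _; rewrite sqr_ge0.
Qed.

Lemma l2_eq0 v : l2norm v = 0 -> v = 0.
Proof.
move=> v0; apply/rowP => i; rewrite mxE; apply: eq0_normc.
by apply/eqP; rewrite eq_le normc_ge0 -v0 normc_le_l2.
Qed.

Lemma l2norm0 : l2norm 0 = 0.
Proof. by rewrite /l2norm big1 ?sqrtr0 // => i _; rewrite mxE normc0 expr0n. Qed.

Lemma l2normZ a v : l2norm (a *: v) = normc a * l2norm v.
Proof.
have /eqP := l2_sqr (a *: v).
have -> : \sum_i normc ((a *: v) 0 i) ^+ 2 = (normc a * l2norm v) ^+ 2.
  rewrite exprMn (l2_sqr v) mulr_sumr; apply: eq_bigr => i _.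
  by rewrite mxE normcM exprMn.
by rewrite eqrXn2 ?l2_ge0 ?mulr_ge0 ?l2_ge0 ?normc_ge0 // => /eqP.
Qed.

Lemma Re_le_normc (a : C) : complex.Re a <= normc a.
Proof.
case: a => x y /=; rewrite (le_trans (ler_norm x)) // -sqrtr_sqr.
by rewrite ler_wsqrtr // lerDl sqr_ge0.
Qed.

Lemma l2_sqr_Re v : l2norm v ^+ 2 = complex.Re (dotmx v v).
Proof. by rewrite dot_l2. Qed.

Lemma l2normD u v : l2norm (u + v) <= l2norm u + l2norm v.
Proof.
rewrite -ler_sqr ?nnegrE ?addr_ge0 ?l2_ge0 // l2_sqr_Re.
rewrite !(dotD, dotDr) (dotC u v) !dot_l2.
have := le_trans (Re_le_normc _) (normc_dot_le u v).
move: (dotmx u v) (l2norm u) (l2norm v) => [a b] U V /=; lra.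
Qed.

Lemma l2_sum (I : finType) (F : I -> 'rV[C]_n) :
  l2norm (\sum_i F i) <= \sum_i l2norm (F i).
Proof.
elim/big_ind2: _ => [|a x b y lax lby|//]; first by rewrite l2norm0.
by apply: le_trans (l2normD _ _) _; rewrite lerD.
Qed.

Lemma l2_le_normc v : l2norm v <= \sum_i normc (v 0 i).
Proof.
have s0 : 0 <= \sum_i normc (v 0 i) by apply: sumr_ge0 => i _; apply: normc_ge0.
rewrite -ler_sqr ?nnegrE ?l2_ge0 // l2_sqr expr2 mulr_suml ler_sum // => i _.
rewrite expr2 ler_wpM2l ?normc_ge0 // (bigD1 i) //= lerDl.
by apply: sumr_ge0 => j _; apply: normc_ge0.
Qed.

End ComplexNorm.

Section OperatorNorm.
Variables (R : realType) (n : nat).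
Local Notation C := R[i].
Implicit Types (x y : 'M[C]_n) (v : 'rV[C]_n).

(** Matrices act on row vectors from the right, in accordance with the convention of
    [dotmx]. *)
Definition op_bound x (c : R) := 0 <= c /\ forall v, l2norm (v *m x) <= c * l2norm v.

Definition opnorm x : R := inf [set c | op_bound x c].

Lemma entries_bound x : op_bound x (\sum_i \sum_j normc (x i j)).
Proof.
split=> [|v].
  by do 2!apply: sumr_ge0 => ? _; apply: normc_ge0.
rewrite mulmx_sum_row (le_trans (l2_sum _)) // mulr_suml ler_sum // => i _.
rewrite l2normZ mulrC ler_pM ?l2_ge0 ?normc_ge0 ?normc_le_l2 //.
by rewrite (le_trans (l2_le_normc _)) // ler_sum // => j _; rewrite mxE.
Qed.

Lemma opnorm_inf x : has_inf [set c | op_bound x c].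
Proof.
split; first by exists (\sum_i \sum_j normc (x i j)); apply: entries_bound.
by exists 0 => c [].
Qed.

Lemma opnorm_min x c : op_bound x c -> opnorm x <= c.
Proof. by move=> bc; apply: ge_inf => //; have [] := opnorm_inf x. Qed.

Lemma opnorm_ge0 x : 0 <= opnorm x.
Proof. by apply: lb_le_inf => [|c []] //; have [] := opnorm_inf x. Qed.

Lemma opnorm_op_bound x : op_bound x (opnorm x).
Proof.
split=> [|v]; first exact: opnorm_ge0.
have [v0|v0] := eqVneq (l2norm v) 0.
  by rewrite (l2_eq0 v0) mul0mx l2norm0 mulr0.
have nv : 0 < l2norm v by rewrite lt_def v0 l2_ge0.
rewrite -ler_pdivrMr //; apply: lb_le_inf => [|c [_ bc]] //.
  by have [] := opnorm_inf x.
by rewrite ler_pdivrMr.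
Qed.

Lemma opnorm_le x v : l2norm (v *m x) <= opnorm x * l2norm v.
Proof. by have [] := opnorm_op_bound x. Qed.

Lemma normc_le_opnorm x i j : normc (x i j) <= opnorm x.
Proof.
have := opnorm_le x (delta_mx 0 i); rewrite -rowE.
have -> : l2norm (delta_mx 0 i : 'rV[C]_n) = 1.
  apply/eqP; rewrite -(@eqrXn2 _ 2) ?l2_ge0 // l2_sqr (bigD1 i) //= big1.
    by rewrite mxE !eqxx normc1 addr0 expr1n.
  by move=> k ki; rewrite mxE (negPf ki) andbF normc0 expr0n.
rewrite mulr1; apply: le_trans.
by have := normc_le_l2 (row i x) j; rewrite mxE.
Qed.

Lemma opnorm_eq0 x : opnorm x = 0 -> x = 0.
Proof.
move=> x0; apply/matrixP => i j; rewrite mxE; apply: eq0_normc.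
by apply/eqP; rewrite eq_le normc_ge0 -x0 normc_le_opnorm.
Qed.

Lemma opnormD x y : opnorm (x + y) <= opnorm x + opnorm y.
Proof.
apply: opnorm_min; split=> [|v]; first by rewrite addr_ge0 ?opnorm_ge0.
by rewrite mulmxDr (le_trans (l2normD _ _)) // mulrDl lerD ?opnorm_le.
Qed.

Lemma opnormM x y : opnorm (x *m y) <= opnorm x * opnorm y.
Proof.
apply: opnorm_min; split=> [|v]; first by rewrite mulr_ge0 ?opnorm_ge0.
rewrite mulmxA (le_trans (opnorm_le _ _)) // mulrAC mulrC.
by rewrite ler_wpM2r ?opnorm_ge0 // opnorm_le.
Qed.

Lemma opnormZ_le a x : opnorm (a *: x) <= normc a * opnorm x.
Proof.
apply: opnorm_min; split=> [|v]; first by rewrite mulr_ge0 ?opnorm_ge0 ?normc_ge0.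
by rewrite -scalemxAr l2normZ -mulrA ler_wpM2l ?normc_ge0 ?opnorm_le.
Qed.

Lemma opnormZ a x : opnorm (a *: x) = normc a * opnorm x.
Proof.
apply: le_anti; rewrite opnormZ_le /=.
have [->|a0] := eqVneq a 0; first by rewrite normc0 mul0r opnorm_ge0.
have na : 0 < normc a.
  by rewrite lt_def normc_ge0 andbT; apply: contra a0 => /eqP/eq0_normc->.
have := opnormZ_le a^-1 (a *: x).
by rewrite scalerA mulVf // scale1r normcV -ler_pdivrMl ?invr_gt0 // invrK.
Qed.

(** For [w = v x*], the square of the norm of [w] is the inner product of [w x] and
    [v]. *)
Lemma opnorm_adj_le x : opnorm (x ^t*) <= opnorm x.
Proof.
apply: opnorm_min; split=> [|v]; first exact: opnorm_ge0.
set w := v *m x ^t*.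
have [w0|w0] := eqVneq (l2norm w) 0.
  by rewrite w0 mulr_ge0 ?opnorm_ge0 ?l2_ge0.
have nw : 0 < l2norm w by rewrite lt_def w0 l2_ge0.
rewrite -(ler_pM2r nw) -expr2.
have -> : l2norm w ^+ 2 = complex.Re (dotmx (w *m x) v) by rewrite dot_adj l2_sqr_Re.
apply: le_trans (Re_le_normc _) _; apply: le_trans (normc_dot_le _ _) _.
by rewrite mulrAC ler_wpM2r ?l2_ge0 // opnorm_le.
Qed.

Lemma opnorm_adj x : opnorm (x ^t*) = opnorm x.
Proof.
by apply: le_anti; rewrite opnorm_adj_le -{1}(trmxCK x) opnorm_adj_le.
Qed.

Lemma opnorm_adjM x : opnorm (x ^t* *m x) = opnorm x ^+ 2.
Proof.
apply: le_anti; apply/andP; split.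
  by rewrite (le_trans (opnormM _ _)) // opnorm_adj expr2.
rewrite -opnorm_adj -[leRHS]sqr_sqrtr ?opnorm_ge0 //.
rewrite ler_sqr ?nnegrE ?opnorm_ge0 ?sqrtr_ge0 //.
apply: opnorm_min; split=> [|v]; first exact: sqrtr_ge0.
rewrite -ler_sqr ?nnegrE ?mulr_ge0 ?sqrtr_ge0 ?l2_ge0 //.
have -> : l2norm (v *m x ^t*) ^+ 2 = complex.Re (dotmx (v *m (x ^t* *m x)) v).
  by rewrite mulmxA dot_adj l2_sqr_Re.
apply: le_trans (Re_le_normc _) _; apply: le_trans (normc_dot_le _ _) _.
rewrite exprMn sqr_sqrtr ?opnorm_ge0 // expr2 mulrA.
by rewrite ler_wpM2r ?l2_ge0 // opnorm_le.
Qed.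

End OperatorNorm.

Section MatrixCStar.
Variable R : realType.

(** The limit is the supremum of the numbers that are eventually below [u]. *)
Lemma real_complete (u : nat -> R) :
  (forall e, 0 < e -> exists N, forall m n, (N <= m)%N -> (N <= n)%N ->
     `|u m - u n| < e) ->
  exists l, forall e, 0 < e -> exists N, forall n, (N <= n)%N -> `|u n - l| < e.
Proof.
move=> cu.
pose A := [set r : R | exists N, forall n : nat, (N <= n)%N -> r <= u n]%classic.
have near_u e : 0 < e -> exists N, [/\ forall n, (N <= n)%N -> `|u n - u N| < e,
    A (u N - e) & ubound A (u N + e)].
  move=> /cu[N uN]; exists N; split=> [n Nn||r [M rM]]; first exact: uN.
    exists N => n Nn; have := uN _ _ Nn (leqnn N).
    by rewrite ltr_norml ltrBrDl => /andP[/ltW].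
  have := uN (maxn M N) _ (leq_maxr _ _) (leqnn N).
  rewrite ltr_norml ltrBlDl => /andP[_ /ltW]; apply: le_trans.
  by rewrite rM ?leq_maxl.
exists (sup A) => e e0.
have e2 : 0 < e / 2 by rewrite divr_gt0.
have [N [uN AN ubN]] := near_u _ e2; exists N => n Nn.
have supA : has_sup A by split; [exists (u N - e / 2) | exists (u N + e / 2)].
have lo : u N - e / 2 <= sup A by apply: ub_le_sup => //; case: supA.
have hi : sup A <= u N + e / 2 by apply: ge_sup => //; case: supA.
rewrite -(subrK (u N) (u n)) -addrA (le_lt_trans (ler_normD _ _)) //.
rewrite [ltRHS]splitr ltr_leD ?uN // ler_norml.
by apply/andP; split; lra.
Qed.

Lemma complex_complete (u : nat -> R[i]) :
  (forall e, 0 < e -> exists N, forall m n, (N <= m)%N -> (N <= n)%N ->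
     normc (u m - u n) < e) ->
  exists l, forall e, 0 < e -> exists N, forall n, (N <= n)%N -> normc (u n - l) < e.
Proof.
have Re_n (a : R[i]) : `|complex.Re a| <= normc a.
  by case: a => x y /=; rewrite -sqrtr_sqr ler_wsqrtr // lerDl sqr_ge0.
have Im_n (a : R[i]) : `|complex.Im a| <= normc a.
  by case: a => x y /=; rewrite -sqrtr_sqr ler_wsqrtr // lerDr sqr_ge0.
have n_ReIm (a : R[i]) : normc a <= `|complex.Re a| + `|complex.Im a|.
  case: a => x y /=; rewrite -[leRHS]ger0_norm ?addr_ge0 // -sqrtr_sqr.
  rewrite ler_wsqrtr // sqrrD !real_normK ?num_real // -addrA lerD2l lerDr.
  by rewrite mulrn_wge0 // mulr_ge0.
move=> cu.
have [e /cu[N uN]|a la] := real_complete (u := fun n => complex.Re (u n)).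
  exists N => m n Nm Nn; apply: le_lt_trans (uN m n Nm Nn).
  by rewrite -raddfB Re_n.
have [e /cu[N uN]|b lb] := real_complete (u := fun n => complex.Im (u n)).
  exists N => m n Nm Nn; apply: le_lt_trans (uN m n Nm Nn).
  by rewrite -raddfB Im_n.
exists (a +i* b)%C => e e0; have e2 : 0 < e / 2 by rewrite divr_gt0.
have [M aM] := la _ e2; have [N bN] := lb _ e2.
exists (maxn M N) => n; rewrite geq_max => /andP[/aM ha /bN hb].
apply: le_lt_trans (n_ReIm _) _; rewrite [ltRHS]splitr.
by move: ha hb; case: (u n) => x y /= ha hb; rewrite ltrD.
Qed.

(** Entries are bounded by the operator norm, which is bounded by the sum of the
    moduli of the entries; so completeness is inherited from the entries. *)
Lemma mx_complete n (x : nat -> 'M[R[i]]_n) :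
  (forall e, 0 < e -> exists N, forall m k, (N <= m)%N -> (N <= k)%N ->
     opnorm (x m - x k) < e) ->
  exists l, forall e, 0 < e -> exists N, forall k, (N <= k)%N -> opnorm (x k - l) < e.
Proof.
move=> cx.
have lim (ij : 'I_n * 'I_n) : exists l, forall e, 0 < e ->
    exists N, forall k, (N <= k)%N -> normc (x k ij.1 ij.2 - l) < e.
  apply: complex_complete => e /cx[N xN]; exists N => m k Nm Nk.
  apply: le_lt_trans (xN m k Nm Nk).
  by have := normc_le_opnorm (x m - x k) ij.1 ij.2; rewrite !mxE.
have [l lP] := choice lim.
exists (\matrix_(i, j) l (i, j)) => e e0.
pose d := e / (n * n).+1%:R.
have d0 : 0 < d by rewrite divr_gt0.
have [N NP] := choice (fun ij => lP ij d d0).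
exists (\max_ij N ij) => k Nk.
apply: (le_lt_trans (opnorm_min (entries_bound (x k - \matrix_(i, j) l (i, j))))).
have de : (n * n).+1%:R * d = e by rewrite mulrC divfK ?pnatr_eq0.
rewrite -[ltRHS]de.
apply: (@le_lt_trans _ _ (\sum_(i < n) \sum_(j < n) d)).
  apply: ler_sum => i _; apply: ler_sum => j _; apply: ltW.
  have := NP (i, j) k; rewrite !mxE; apply.
  by apply: leq_trans Nk; apply: (leq_bigmax (i, j)).
by rewrite !sumr_const !card_ord -mulrnA -[ltLHS]mulr_natl ltr_pM2r ?ltr_nat.
Qed.

End MatrixCStar.

(** An alias, so that plain matrices do not receive the operator norm. *)
Definition matrix_cstar (R : realType) n := 'M[R[i]]_n.+1.

Section MatrixCStarInstance.
Variables (R : realType) (n : nat).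

HB.instance Definition _ := GRing.Algebra.copy (matrix_cstar R n) 'M[R[i]]_n.+1.

Implicit Types x y : matrix_cstar R n.

Fact mx_starD x y : (x + y) ^t* = x ^t* + y ^t*.
Proof. by rewrite linearD map_mxD. Qed.

Fact mx_starZ a x : (a *: x) ^t* = a^* *: x ^t*.
Proof. by rewrite linearZ map_mxZ. Qed.

Fact mx_starM x y : (x * y) ^t* = y ^t* * x ^t*.
Proof. by rewrite [x * y]/(x *m y) trmx_mul map_mxM. Qed.

HB.instance Definition _ := isCStarAlgebra.Build R (matrix_cstar R n)
  mx_starD mx_starZ mx_starM (@trmxCK _ _ _) (@opnorm_eq0 _ _)
  (@opnormD _ _) (@opnormZ _ _) (@opnormM _ _) (@opnorm_adjM _ _)
  (@mx_complete _ _).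

End MatrixCStarInstance.

(** * Partial characters of SL_4 *)

Section PartialCharacters.
Variable F : fieldType.

Definition sl_involution n (x : 'M[F]_n) := (x *m x == 1%:M) && (\det x == 1).

(** An assignment that is multiplicative on commuting involutions only, written
    additively. *)
Definition partial_character n (f : 'M[F]_n -> bool) :=
  forall x y, sl_involution x -> sl_involution y -> x *m y = y *m x ->
    f (x *m y) = f x (+) f y.

Lemma sl_involution1 n : sl_involution (1%:M : 'M[F]_n).
Proof. by rewrite /sl_involution mulmx1 det1 !eqxx. Qed.

Lemma partial_character1 n (f : 'M[F]_n -> bool) :
  partial_character f -> f 1%:M = false.
Proof.
move=> pf; have := pf _ _ (sl_involution1 n) (sl_involution1 n) erefl.
by rewrite mulmx1 addbb.
Qed.

Lemma sl_involution_conj n (g h x : 'M[F]_n) : g *m h = 1%:M ->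
  sl_involution x -> sl_involution (g *m x *m h).
Proof.
move=> gh; have hg := mulmx1C gh; rewrite /sl_involution => /andP[/eqP xx /eqP dx].
apply/andP; split; apply/eqP.
  by rewrite !mulmxA -(mulmxA (g *m x)) hg mulmx1 -(mulmxA g) xx mulmx1.
by rewrite !det_mulmx dx mulr1 -det_mulmx gh det1.
Qed.

Lemma sl_involutionM n (x y : 'M[F]_n) : x *m y = y *m x ->
  sl_involution x -> sl_involution y -> sl_involution (x *m y).
Proof.
move=> xy /andP[/eqP xx /eqP dx] /andP[/eqP yy /eqP dy].
rewrite /sl_involution det_mulmx dx dy mulr1 eqxx andbT.
by rewrite {2}xy mulmxA -(mulmxA x) yy mulmx1 xx.
Qed.

Lemma partial_character_conj n (f : 'M[F]_n -> bool) (g h : 'M[F]_n) :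
  g *m h = 1%:M -> partial_character f ->
  partial_character (fun x => f (g *m x *m h)).
Proof.
move=> gh pf x y sx sy xy; have hg := mulmx1C gh.
have conjM a b : g *m (a *m b) *m h = (g *m a *m h) *m (g *m b *m h).
  by rewrite !mulmxA -(mulmxA (g *m a) h) hg mulmx1.
by rewrite conjM pf ?sl_involution_conj // -!conjM xy.
Qed.

Lemma partial_character_tr n (f : 'M[F]_n -> bool) :
  partial_character f -> partial_character (fun x => f x^T).
Proof.
move=> pf x y sx sy xy; have str a : sl_involution a -> sl_involution a^T.
  move=> /andP[/eqP aa da]; rewrite /sl_involution det_tr da andbT.
  by rewrite -trmx_mul aa trmx1.
by rewrite xy trmx_mul pf ?str // -!trmx_mul xy.
Qed.

(** Outside characteristic 2, this is the conjugate of [diag(-1, -1, 1, 1)] by the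
    unipotent matrix with upper right block [E / 2]. *)
Definition half_turn (E : 'M[F]_2) : 'M[F]_(2 + 2) := block_mx (- 1%:M) E 0 1%:M.

Lemma det_opp2 (p : 'M[F]_2) : \det (- p) = \det p.
Proof. by rewrite -scaleN1r detZ sqrrN expr1n mul1r. Qed.

(** The hypotheses say that conjugation by the block matrix [diag(p, q)] fixes the
    block [E] and negates [E'].  Then [half_turn (E + E')] is the product of two
    commuting involutions, the one depending only on [E'] and the other only on [E],
    so that [f (half_turn (E + E'))] is a function of [E'] plus a function of [E]. *)
Lemma partial_character_half_turnD (f : 'M[F]_(2 + 2) -> bool) (p q E E' : 'M[F]_2) :
  partial_character f ->
  p *m p = 1%:M -> q *m q = 1%:M -> \det p = -1 -> \det q = -1 ->
  p *m E = E *m q -> p *m E' = - (E' *m q) ->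
  f (half_turn (E + E')) = f (half_turn E) (+) f (half_turn E') (+) f (half_turn 0).
Proof.
move=> pf pp qq dp dq pE pE'.
pose Y A : 'M[F]_(2 + 2) := block_mx p (A *m q) 0 q.
pose Y' A : 'M[F]_(2 + 2) := block_mx (- p) (A *m q) 0 q.
suff split_f A A' : p *m A = A *m q -> p *m A' = - (A' *m q) ->
    f (half_turn (A + A')) = f (Y A') (+) f (Y' A).
  have := split_f E E' pE pE'; have := split_f E 0 pE.
  have := split_f 0 E' _ pE'; have := split_f 0 0.
  rewrite !mulmx0 !mul0mx oppr0 !addr0 !add0r => -> // -> // -> // ->.
  by case: (f (Y _)); case: (f (Y' _)); case: (f (Y 0)); case: (f (Y' 0)).
move=> pA pA'.
have dpq : \det p * \det q = 1 by rewrite dp dq mulrNN mulr1.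
have sY : sl_involution (Y A').
  rewrite /sl_involution det_ublock dpq eqxx andbT mulmx_block.
  rewrite !(mulmx0, mul0mx, addr0, add0r) mulmxA pA' -!mulmxA pp qq mulNmx -mulmxA qq.
  by rewrite mulmx1 addNr -scalar_mx_block.
have sY' : sl_involution (Y' A).
  rewrite /sl_involution det_ublock det_opp2 dpq eqxx andbT mulmx_block.
  rewrite !(mulmx0, mul0mx, addr0, add0r) mulNmx mulmxN mulNmx opprK mulmxA pA.
  by rewrite -!mulmxA pp qq mulmx1 addNr -scalar_mx_block.
have prodE : half_turn (A + A') = Y A' *m Y' A.
  rewrite mulmx_block !(mulmx0, mul0mx, addr0, add0r) mulmxN pp qq.
  by rewrite mulmxA pA -!mulmxA qq !mulmx1.
rewrite prodE pf // -prodE mulmx_block !(mulmx0, mul0mx, addr0, add0r) mulNmx pp qq.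
by rewrite mulNmx mulmxA pA' mulNmx opprK -!mulmxA qq !mulmx1 addrC.
Qed.

Definition mx2 (a b c d : F) : 'M[F]_2 :=
  \matrix_(i, j) if i == 0 then (if j == 0 then a else b)
                 else (if j == 0 then c else d).

Lemma mx2_eq a b c d a' b' c' d' :
  a = a' -> b = b' -> c = c' -> d = d' -> mx2 a b c d = mx2 a' b' c' d'.
Proof. by move=> -> -> -> ->. Qed.

Lemma mx2M a b c d a' b' c' d' : mx2 a b c d *m mx2 a' b' c' d' =
  mx2 (a * a' + b * c') (a * b' + b * d') (c * a' + d * c') (c * b' + d * d').
Proof.
apply/matrixP => i j; rewrite !mxE !big_ord_recl big_ord0 !mxE /= addr0.
by case: ifP => _; case: ifP.
Qed.

Lemma mx2D a b c d a' b' c' d' :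
  mx2 a b c d + mx2 a' b' c' d' = mx2 (a + a') (b + b') (c + c') (d + d').
Proof. by apply/matrixP => i j; rewrite !mxE; do 2!case: ifP => _. Qed.

Lemma mx2N a b c d : - mx2 a b c d = mx2 (- a) (- b) (- c) (- d).
Proof. by apply/matrixP => i j; rewrite !mxE; do 2!case: ifP => _. Qed.

Lemma mx2_1 : 1%:M = mx2 1 0 0 1.
Proof. by apply/matrixP => i j; rewrite !mxE; case: i j => [[|[|?]] ?] [[|[|?]] ?]. Qed.

Lemma mx2_0 : 0 = mx2 0 0 0 0.
Proof. by apply/matrixP => i j; rewrite !mxE; do 2!case: ifP => _. Qed.

Lemma det_mx2 a b c d : \det (mx2 a b c d) = a * d - b * c.
Proof.
rewrite (expand_det_row _ 0) !big_ord_recl big_ord0 /cofactor !det_mx11 !mxE /=.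
by rewrite addr0 expr0 expr1 mul1r mulN1r mulrN.
Qed.

Lemma mx2_tr a b c d : (mx2 a b c d)^T = mx2 a c b d.
Proof. by apply/matrixP => i j; rewrite !mxE; case: ifP => _; case: ifP. Qed.

Ltac mx2_ring :=
  rewrite ?(mx2_1, mx2_0, mx2N) ?(mx2M, mx2D, mx2N, mx2_tr);
  try apply: mx2_eq; ring.

(** Let [D r] be [f] at the half-turn whose block has second row [r], minus [f] at
    [half_turn 0].  For a reflection [q] of the plane, [D] is additive on sums of a
    vector fixed by [q] and a vector negated by [q].  With [e = (c, 0)] and
    [h = (0, c)], three reflections give [D (2e) = D (e + h) + D (e - h)],
    [D (e + h) = D e + D h] with its analogue for [-h], and
    [D e = D (e + h) + D (-h)].  Together they yield [D (2e) = 0]. *)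
Lemma partial_character_transvection (f : 'M[F]_(2 + 2) -> bool) c :
  partial_character f -> f (half_turn (mx2 0 0 (2 * c) 0)) = f (half_turn 0).
Proof.
move=> pf; pose r a b := half_turn (mx2 0 0 (a * c) (b * c)).
have p1 : mx2 (-1) 0 0 1 *m mx2 (-1) 0 0 1 = 1%:M by mx2_ring.
have dp : \det (mx2 (-1) 0 0 1) = -1 by rewrite det_mx2; ring.
have split_r q a b a' b' : q *m q = 1%:M -> \det q = -1 ->
    mx2 0 0 (a * c) (b * c) *m q = mx2 0 0 (a * c) (b * c) ->
    mx2 0 0 (a' * c) (b' * c) *m q = - mx2 0 0 (a' * c) (b' * c) ->
    f (r (a + a') (b + b')) = f (r a b) (+) f (r a' b') (+) f (half_turn 0).
  move=> qq dq Eq E'q; rewrite /r -(partial_character_half_turnD pf p1 qq dp dq).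
  - by congr (f (half_turn _)); mx2_ring.
  - by rewrite Eq; mx2_ring.
  - by rewrite E'q; mx2_ring.
have f01 a b : f (r a b) = f (r a 0) (+) f (r 0 b) (+) f (half_turn 0).
  rewrite -(split_r (mx2 1 0 0 (-1))) ?addr0 ?add0r //; try mx2_ring.
  by rewrite det_mx2; ring.
have f2 : f (r 2 0) = f (r 1 1) (+) f (r 1 (-1)) (+) f (half_turn 0).
  rewrite -(split_r (mx2 0 1 1 0)) ?subrr //; try mx2_ring.
  by rewrite det_mx2; ring.
have f3 : f (r 1 0) = f (r 1 1) (+) f (r 0 (-1)) (+) f (half_turn 0).
  rewrite -(split_r (mx2 1 2 0 (-1))) ?addr0 ?subrr //; try mx2_ring.
  by rewrite det_mx2; ring.
have -> : half_turn (mx2 0 0 (2 * c) 0) = r 2 0 by rewrite /r mul0r.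
rewrite f2; move: f3; rewrite (f01 1 1) (f01 1 (-1)).
by case: (f (r 1 0)) (f (r 0 1)) (f (r 0 (-1))) (f (half_turn 0)) => [] [] [] [].
Qed.

Definition E21 := mx2 0 0 1 0.
Definition upper : 'M[F]_(2 + 2) := block_mx 1%:M E21 0 1%:M.
Definition upperV : 'M[F]_(2 + 2) := block_mx 1%:M (- E21) 0 1%:M.
Definition lower : 'M[F]_(2 + 2) := upperV^T.
Definition lowerV : 'M[F]_(2 + 2) := upper^T.

Lemma upperK : upper *m upperV = 1%:M.
Proof.
rewrite mulmx_block !(mulmx0, mul0mx, addr0, add0r, mulmx1, mul1mx) addNr.
by rewrite -scalar_mx_block.
Qed.

Lemma lowerK : lower *m lowerV = 1%:M.
Proof. by rewrite -trmx_mul upperK trmx1. Qed.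

Lemma upper_half_turn : upper *m half_turn 0 *m upperV = half_turn (mx2 0 0 (2 * 1) 0).
Proof.
rewrite !mulmx_block !(mulmx0, mul0mx, addr0, add0r, mulmx1, mul1mx).
rewrite mulNmx mul1mx opprK /E21; congr block_mx; mx2_ring.
Qed.

Lemma partial_character_upper (f : 'M[F]_(2 + 2) -> bool) :
  partial_character f -> f (upper *m half_turn 0 *m upperV) = f (half_turn 0).
Proof. by move=> pf; rewrite upper_half_turn partial_character_transvection. Qed.

Lemma partial_character_lower (f : 'M[F]_(2 + 2) -> bool) :
  partial_character f -> f (lower *m half_turn 0 *m lowerV) = f (half_turn 0).
Proof.
move=> pf; have half_turn_tr : (half_turn 0)^T = half_turn 0.
  by rewrite tr_block_mx linearN /= trmx1 trmx0.
have -> : lower *m half_turn 0 *m lowerV = (upper *m (half_turn 0) *m upperV)^T.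
  by rewrite !trmx_mul half_turn_tr mulmxA.
by rewrite (partial_character_upper (partial_character_tr pf)) half_turn_tr.
Qed.

Definition flip13 : 'M[F]_(2 + 2) := block_mx (mx2 (-1) 0 0 1) 0 0 (mx2 (-1) 0 0 1).
Definition flip23 : 'M[F]_(2 + 2) := block_mx (mx2 1 0 0 (-1)) 0 0 (mx2 (-1) 0 0 1).

(** The product of the three transvections exchanges the second and third
    coordinates, up to signs. *)
Lemma weyl_half_turn :
  upper *m (lower *m (upper *m half_turn 0 *m upperV) *m lowerV) *m upperV = flip13.
Proof.
rewrite upper_half_turn /lower /lowerV /upper /upperV /half_turn.
rewrite !tr_block_mx !(trmx0, trmx1, linearN).
rewrite /= /flip13 /E21 ?mx2_1 ?mx2_0 !mx2_tr !mx2N !mulmx_block !(mx2M, mx2D).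
by congr block_mx; apply: mx2_eq; ring.
Qed.

(** Each of the three transvections preserves the value of every partial character,
    and hence so does their product. *)
Lemma partial_character_flip13 (f : 'M[F]_(2 + 2) -> bool) :
  partial_character f -> f flip13 = f (half_turn 0).
Proof.
move=> pf; have pfu := partial_character_conj upperK pf.
have pful := partial_character_conj lowerK pfu.
rewrite -weyl_half_turn.
rewrite -[RHS](partial_character_upper pf) -[RHS](partial_character_lower pfu).
by rewrite -[RHS](partial_character_upper pful).
Qed.

Lemma sl_involution_half_turn0 : sl_involution (half_turn 0).
Proof.
rewrite /sl_involution det_ublock det_opp2 det1 mulr1 eqxx andbT mulmx_block.
rewrite !(mulmx0, mul0mx, addr0, add0r, mulmx1, mul1mx) mulNmx mul1mx opprK.
by rewrite -scalar_mx_block.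
Qed.

Lemma sl_involution_flip13 : sl_involution flip13.
Proof.
rewrite /sl_involution /flip13 det_ublock !det_mx2 mulmx_block.
rewrite !(mulmx0, mul0mx, addr0, add0r) mx2M.
apply/andP; split; apply/eqP; last by ring.
by rewrite scalar_mx_block; congr block_mx; mx2_ring.
Qed.

(** The matrix [flip23] is the product of [half_turn 0] and [flip13], at which [f]
    takes the same value. *)
Lemma partial_character_flip23 (f : 'M[F]_(2 + 2) -> bool) :
  partial_character f -> f flip23 = false.
Proof.
move=> pf.
have -> : flip23 = half_turn 0 *m flip13.
  rewrite /half_turn /flip13 /flip23 ?mx2_1 ?mx2_0 !mx2N !mulmx_block !(mx2M, mx2D).
  by congr block_mx; apply: mx2_eq; ring.
rewrite pf ?sl_involution_half_turn0 ?sl_involution_flip13 //.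
  by rewrite partial_character_flip13 // addbb.
rewrite !mulmx_block !(mulmx0, mul0mx, addr0, add0r, mulmx1, mul1mx).
by rewrite mulNmx mulmxN mulmx1 mul1mx.
Qed.

Lemma flip23_diag : flip23 =
  diag_mx (\row_(i < 4) if (i == 1%N :> nat) || (i == 2%N :> nat) then -1 else 1).
Proof.
pose l b : 'rV[F]_2 := \row_j if (j == 0) == b then -1 else 1.
have -> : flip23 = diag_mx (row_mx (l false) (l true)).
  rewrite diag_mx_row /flip23; congr block_mx; apply/matrixP => i j; rewrite !mxE;
  by case: i j => [[|[|?]] ?] [[|[|?]] ?].
congr diag_mx; apply/rowP => i; rewrite !mxE.
by case: (@splitP 2 2 i) => j ->; rewrite mxE; case: j => [[|[|?]] ?].
Qed.

Lemma conj_perm_diag n (s : 'S_n) (d : 'rV[F]_n) :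
  perm_mx s *m diag_mx d *m perm_mx s^-1 = diag_mx (\row_i d 0 (s i)).
Proof.
rewrite -row_permE -col_permE; apply/matrixP => i j; rewrite !mxE.
by rewrite (inj_eq perm_inj).
Qed.

Definition flip_pair (a : F) (i : 'I_4) : 'rV[F]_4 :=
  \row_k if (k == i) || (k == ord_max) then a else 1.

Lemma partial_character_flip_pair (f : 'M[F]_4 -> bool) i :
  partial_character f -> i != ord_max -> f (diag_mx (flip_pair (-1) i)) = false.
Proof.
move=> pf i3.
(* The coordinates are numbered from 0, so that [flip23] flips 1 and 2. *)
pose one : 'I_4 := inord 1; pose two : 'I_4 := inord 2.
pose j := tperm i one ord_max; pose s := (tperm i one * tperm j two)%g.
have one_two : one != two by rewrite -val_eqE /= !inordK.
have si : s i = one.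
  rewrite permM tpermL tpermD // eq_sym //.
  by rewrite -(tpermL i one) (inj_eq perm_inj).
have s3 : s ord_max = two by rewrite permM tpermL.
have ss : perm_mx s *m perm_mx s^-1 = 1%:M :> 'M[F]_4.
  by rewrite -perm_mxM mulgV perm_mx1.
have := partial_character_flip23 (partial_character_conj ss pf).
rewrite flip23_diag conj_perm_diag => <-; congr (f (diag_mx _)).
apply/rowP => k; rewrite !mxE.
have -> : (s k == 1%N :> nat) = (k == i).
  by rewrite -(inj_eq (@perm_inj _ s)) si -val_eqE /= inordK.
have -> // : (s k == 2%N :> nat) = (k == ord_max).
by rewrite -(inj_eq (@perm_inj _ s)) s3 -val_eqE /= inordK.
Qed.

(** An involution of determinant 1 is diagonalizable with an even number of entries
    -1, so it is conjugate to a product of matrices that flip one of the first three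
    coordinates together with the last. *)
Theorem partial_character_trivial (f : 'M[F]_4 -> bool) x : 2 != 0 :> F ->
  partial_character f -> sl_involution x -> f x = false.
Proof.
move=> two_neq0 pf sx; have /andP[/eqP xx /eqP dx] := sx.
have [P Pu /(diagonalizable_forLR Pu)[d xE]] : diagonalizable x.
  apply/diagonalizableP; exists [:: 1; -1].
    by rewrite /= inE andbT -subr_eq0 opprK.
  apply: mxminpoly_min; rewrite !big_cons big_nil mulr1 polyCN opprK.
  rewrite rmorphM rmorphB rmorphD /= horner_mx_X horner_mx_C.
  rewrite mulrDr mulr1 mulrBl mul1r -[x * x]/(x *m x) xx.
  by rewrite addrA subrK subrr.
have {}xE : x = invmx P *m diag_mx d *m P.
  by rewrite xE mxpoly.conjVmx.
have PP : invmx P *m P = 1%:M by rewrite mulVmx.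
have PP' : P *m invmx P = 1%:M by rewrite mulmxV.
have dE : diag_mx d = P *m x *m invmx P.
  by rewrite xE !mulmxA PP' mul1mx -mulmxA PP' mulmx1.
have /andP[/eqP dd _] := sl_involution_conj PP' sx.
have sign k : d 0 k = 1 \/ d 0 k = -1.
  move: dd; rewrite -dE mulmx_diag => /matrixP/(_ k k); rewrite !mxE eqxx !mulr1n.
  by move/eqP; rewrite -expr2 sqrf_eq1 => /orP[] /eqP; [left | right].
rewrite xE; move: (partial_character_conj PP pf).
set g := fun _ => _; rewrite -/(g (diag_mx d)) => pg.
have sfp i : i != ord_max -> sl_involution (diag_mx (flip_pair (d 0 i) i)).
  move=> i3; have aa : d 0 i * d 0 i = 1 by case: (sign i) => ->; ring.
  apply/andP; split; apply/eqP.
    rewrite mulmx_diag -diag_const_mx; congr diag_mx; apply/rowP => k; rewrite !mxE.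
    by case: ifP => _ //; rewrite mulr1.
  rewrite det_diag (bigD1 i) //= (bigD1 ord_max) 1?eq_sym //= big1 => [|k].
    by rewrite !mxE eqxx /= (eq_sym ord_max) (negPf i3) eqxx mulr1.
  by rewrite mxE => /andP[/negPf-> /negPf->].
have gfp i : i != ord_max -> g (diag_mx (flip_pair (d 0 i) i)) = false.
  move=> i3; case: (sign i) => ->; last exact: partial_character_flip_pair.
  rewrite -(partial_character1 pg) -diag_const_mx; congr (g (diag_mx _)).
  by apply/rowP => k; rewrite !mxE if_same.
pose i0 : 'I_4 := inord 0; pose i1 : 'I_4 := inord 1; pose i2 : 'I_4 := inord 2.
have [n0 n1 n2] : [/\ i0 != ord_max, i1 != ord_max & i2 != ord_max].
  by rewrite -!val_eqE /= !inordK.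
have prod_d : d 0 i0 * d 0 i1 * d 0 i2 * d 0 ord_max = 1.
  have := det_diag d; rewrite dE !det_mulmx dx mulr1 -det_mulmx PP' det1 => ->.
  rewrite (eq_bigr (fun k : 'I_4 => d 0 (inord k))) => [|k _]; last by rewrite inord_val.
  rewrite !big_ord_recl big_ord0 /= mulr1 !mulrA; congr (_ * d 0 _).
  by apply: val_inj; rewrite /= inordK.
have d_prod : diag_mx d = diag_mx (flip_pair (d 0 i0) i0) *m
    (diag_mx (flip_pair (d 0 i1) i1) *m diag_mx (flip_pair (d 0 i2) i2)).
  rewrite !mulmx_diag; congr diag_mx; apply/rowP => k; rewrite !mxE.
  have [->|kmax] := eqVneq k ord_max.
    rewrite !orbT -[d 0 ord_max]mul1r -prod_d mulrA.
    by case: (sign ord_max) => ->; ring.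
  rewrite !orbF.
  have : k \in [:: i0; i1; i2].
    rewrite !inE -!val_eqE /= !inordK //; move: kmax (ltn_ord k); rewrite -val_eqE /=.
    by case: (val k) => [|[|[|[|]]]].
  by rewrite !inE => /or3P[] /eqP->; rewrite -!val_eqE /= !inordK //= !(mulr1, mul1r).
have comm (a b : 'rV[F]_4) : diag_mx a *m diag_mx b = diag_mx b *m diag_mx a.
  exact: diag_mxC.
rewrite d_prod; move: (sfp _ n0) (sfp _ n1) (sfp _ n2) (gfp _ n0) (gfp _ n1) (gfp _ n2).
move: (flip_pair _ _) (flip_pair _ _) (flip_pair _ _) => c b a sa sb sc ga gb gc.
have sbc := sl_involutionM (comm b c) sb sc.
by rewrite pg // ?ga ?pg ?gb ?gc // mulmxA comm -mulmxA (comm a) mulmxA.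
Qed.

End PartialCharacters.

(** * The representation on odd functions *)

Section OddFunctions.
Variables (F : finFieldType) (n : nat).
Hypothesis two_neq0 : 2 != 0 :> F.
Notation V := 'cV[F]_n.
Implicit Types (u v w : V) (x y : 'M[F]_n).

(** An arbitrary choice of one vector in each pair [v, -v]; the functions that are 1
    at such a vector, -1 at its opposite and 0 elsewhere are a basis of the odd
    functions. *)
Definition positive v := (enum_rank v < enum_rank (- v))%N.

Lemma positiveN v : v != 0 -> positive (- v) = ~~ positive v.
Proof.
move=> v0; rewrite /positive opprK ltnNge ltn_neqAle (inj_eq val_inj) negb_and negbK.
rewrite (inj_eq enum_rank_inj) -addr_eq0 -mulr2n -scaler_nat scaler_eq0.
by rewrite (negPf two_neq0) (negPf v0) orbF -ltnNge ltn_neqAle.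
Qed.

Lemma positive_neq0 v : positive v -> v != 0.
Proof. by apply: contraTneq => ->; rewrite /positive oppr0 ltnn. Qed.

Definition positive_vector := {v : V | positive v}.

Lemma pvec_repr v : v != 0 -> exists s : positive_vector, v = val s \/ v = - val s.
Proof.
move=> v0; have [pv|npv] := boolP (positive v); first by exists (Sub v pv); left.
have pv : positive (- v) by rewrite positiveN.
by exists (Sub (- v) pv); right; rewrite opprK.
Qed.

Lemma pvec_neqN (s t : positive_vector) : val s != - val t.
Proof.
apply: contraL (valP s) => /eqP->.
by rewrite positiveN ?negbK ?(valP t) // positive_neq0 ?(valP t).
Qed.

Variable R : realType.
Local Notation C := R[i].

(** The coordinate at [w] of the odd function concentrated at [v] and [-v]. *)
Definition osgn v w : C := (v == w)%:R - (v == - w)%:R.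

Lemma osgnC v w : osgn v w = osgn w v.
Proof. by rewrite /osgn [w == v]eq_sym [w == - v]eq_sym eqr_oppLR. Qed.

Lemma osgnN v w : osgn (- v) w = - osgn v w.
Proof. by rewrite /osgn eqr_oppLR eqr_opp opprB. Qed.

Lemma osgn_pvec (s t : positive_vector) : osgn (val s) (val t) = (s == t)%:R.
Proof. by rewrite /osgn (negPf (pvec_neqN s t)) subr0 (inj_eq val_inj). Qed.

Lemma conj_osgn v w : (osgn v w)^* = osgn v w.
Proof. by rewrite /osgn rmorphB !rmorph_nat. Qed.

Lemma osgn_mul_involution x v w : x *m x = 1%:M -> osgn (x *m v) w = osgn v (x *m w).
Proof.
move=> xx; have xI u u' : (x *m u == u') = (u == x *m u').
  by apply/eqP/eqP => [<-|->]; rewrite mulmxA xx mul1mx.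
by rewrite /osgn !xI mulmxN.
Qed.

(** An odd function is the combination of the basis with its own values. *)
Lemma sum_osgn (G : V -> C) v : (forall u, G (- u) = - G u) -> v != 0 ->
  \sum_(s : positive_vector) G (val s) * osgn v (val s) = G v.
Proof.
move=> G_odd /pvec_repr[s vs].
rewrite (bigD1 s) //= [X in _ + X]big1 => [|t ts].
  by rewrite addr0; case: vs => ->; rewrite ?osgnN osgn_pvec eqxx ?mulrN mulr1 ?G_odd.
by case: vs => ->; rewrite ?osgnN osgn_pvec eq_sym (negPf ts) ?oppr0 mulr0.
Qed.

Variable v0 : positive_vector.

(** Square matrices form a ring only when their size is syntactically a successor, so
    the basis is indexed through its cardinal. *)
Definition hdim := #|{: positive_vector}|.-1.

Lemma hdimE : hdim.+1 = #|{: positive_vector}|.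
Proof. by rewrite prednK //; apply/card_gt0P; exists v0. Qed.

Definition hval (i : 'I_hdim.+1) : V := val (enum_val (cast_ord hdimE i)).

Definition odd_rep x : matrix_cstar R hdim :=
  \matrix_(i, j) osgn (x *m hval j) (hval i).

Lemma sum_hval (G : V -> C) : \sum_i G (hval i) = \sum_(s : positive_vector) G (val s).
Proof.
rewrite [RHS]big_enum_val [RHS](reindex (cast_ord hdimE)) //=.
by exists (cast_ord (esym hdimE)) => i _; rewrite ?cast_ordK ?cast_ordKV.
Qed.

Lemma hval_neq0 i : hval i != 0.
Proof. exact: positive_neq0 (valP _). Qed.

Lemma osgn_hval i k : osgn (hval i) (hval k) = (i == k)%:R.
Proof.
by rewrite /hval osgn_pvec (inj_eq enum_val_inj) (inj_eq (@cast_ord_inj _ _ _)).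
Qed.

Lemma odd_repM x y : y \in unitmx -> odd_rep (x *m y) = odd_rep x * odd_rep y.
Proof.
move=> yu; apply/matrixP => i k; rewrite !mxE -mulmxA.
have yk : y *m hval k != 0.
  by apply: contraNneq (hval_neq0 k) => yk0; rewrite -(mulKmx yu (hval k)) yk0 mulmx0.
rewrite -[LHS](sum_osgn (G := fun u => osgn (x *m u) (hval i))) => [|u|//].
  rewrite -(sum_hval (fun u => osgn (x *m u) (hval i) * osgn (y *m hval k) u)).
  by apply: eq_bigr => l _; rewrite !mxE.
by rewrite mulmxN osgnN.
Qed.

Lemma odd_rep1 : odd_rep 1%:M = 1.
Proof.
by apply/matrixP => i k; rewrite !mxE mul1mx osgn_hval eq_sym.
Qed.

Lemma odd_repN1 : odd_rep (- 1%:M) = -1.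
Proof.
by apply/matrixP => i k; rewrite !mxE mulNmx mul1mx osgnN osgn_hval eq_sym.
Qed.

Lemma star_odd_rep x : x *m x = 1%:M -> star (odd_rep x) = odd_rep x.
Proof.
move=> xx; apply/matrixP => i k; rewrite /star /= !mxE conj_osgn.
by rewrite osgn_mul_involution // osgnC.
Qed.

End OddFunctions.

(** * The two graphs *)

Section Involutions.
Notation K := 'F_3.

Definition observable := {x : 'M[K]_4 | sl_involution x && (x != 1%:M)}.

(** Distinctness of the first two members, with the exclusion of 1, makes all three
    distinct. *)
Definition context := {t : observable * observable * observable |
  [&& t.1.1 != t.1.2, val t.1.1 *m val t.1.2 == val t.2
    & val t.1.2 *m val t.1.1 == val t.2]}.

Definition ctx0 (q : context) : observable := (val q).1.1.
Definition ctx1 (q : context) : observable := (val q).1.2.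
Definition ctx2 (q : context) : observable := (val q).2.

Lemma F3_two_neq0 : 2 != 0 :> K. Proof. by []. Qed.

Lemma observable_sqr (i : observable) : val i *m val i = 1%:M.
Proof. by have /andP[/andP[/eqP]] := valP i. Qed.

Lemma observable_neq1 (i : observable) : val i != 1%:M.
Proof. by have /andP[] := valP i. Qed.

Lemma observable_unit (i : observable) : val i \in unitmx.
Proof. by have := observable_sqr i => /mulmx1_unit[]. Qed.

Lemma ctxM q : val (ctx0 q) *m val (ctx1 q) = val (ctx2 q).
Proof. by case: q => [[[i j] k] /= p]; have /and3P[_ /eqP] := p. Qed.

Lemma ctx01 q : ctx0 q != ctx1 q.
Proof. by case: q => [[[i j] k] /= p]; have /and3P[] := p. Qed.

Lemma ctx02 q : ctx0 q != ctx2 q.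
Proof.
rewrite -(inj_eq val_inj) -ctxM; apply: contraNneq (observable_neq1 (ctx1 q)) => h.
rewrite -[val (ctx1 q)](mulKmx (observable_unit (ctx0 q))) -h.
by rewrite mulVmx // observable_unit.
Qed.

Lemma ctx12 q : ctx1 q != ctx2 q.
Proof.
rewrite -(inj_eq val_inj) -ctxM; apply: contraNneq (observable_neq1 (ctx0 q)) => h.
rewrite -[val (ctx0 q)](mulmxK (observable_unit (ctx1 q))) -h.
by rewrite mulmxV // observable_unit.
Qed.

(** Extended by 0, a solution becomes a partial character: the pairs of commuting
    involutions that do not form a context are those with equal members or with
    the identity as a member, for which the value 0 at the identity is right. *)
Lemma observable_classical (f : observable -> bool) :
  (forall q, f (ctx2 q) = f (ctx0 q) (+) f (ctx1 q)) -> forall i, f i = false.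
Proof.
move=> f_ctx; pose g (x : 'M[K]_4) := if insub x is Some i then f i else false.
have gE (i : observable) : g (val i) = f i by rewrite /g valK.
have g1 : g 1%:M = false by rewrite /g insubF // eqxx andbF.
suff pg : partial_character g.
  move=> i; rewrite -gE; apply: partial_character_trivial F3_two_neq0 pg _.
  by have /andP[] := valP i.
move=> x y sx sy xy.
have [->|x1] := eqVneq x 1%:M; first by rewrite mul1mx g1.
have [->|y1] := eqVneq y 1%:M; first by rewrite mulmx1 g1 addbF.
have [/andP[/eqP xx _] /andP[/eqP yy _]] := (sx, sy).
have [<-|nxy] := eqVneq x y; first by rewrite xx g1 addbb.
have xy1 : x *m y != 1%:M.
  apply: contraNneq nxy => xy1; apply/eqP.
  by rewrite -[LHS]mulmx1 -yy mulmxA xy1 mul1mx.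
have px : sl_involution x && (x != 1%:M) by rewrite sx.
have py : sl_involution y && (y != 1%:M) by rewrite sy.
have pxy : sl_involution (x *m y) && (x *m y != 1%:M) by rewrite sl_involutionM.
pose i : observable := Sub x px; pose j : observable := Sub y py.
pose k : observable := Sub (x *m y) pxy.
have pq : [&& i != j, val i *m val j == val k & val j *m val i == val k].
  by rewrite -(inj_eq val_inj) /= nxy -xy !eqxx.
have := f_ctx (Sub ((i, j), k) pq).
by rewrite /ctx0 /ctx1 /ctx2 !SubK /= -!gE.
Qed.

Lemma minus_one_proof : sl_involution (- 1%:M : 'M[K]_4) && (- 1%:M != 1%:M :> 'M[K]_4).
Proof.
apply/andP; split.
  rewrite /sl_involution mulNmx mul1mx opprK eqxx -scaleN1r detZ det1 mulr1.
  by rewrite -[4%N]/(2 * 2)%N exprM sqrrN !expr1n.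
by apply/eqP => /matrixP/(_ 0 0); rewrite !mxE.
Qed.

Definition minus_one : observable := Sub (- 1%:M) minus_one_proof.

Lemma half_turn0_proof : sl_involution (half_turn 0 : 'M[K]_(2 + 2)) &&
  (half_turn 0 != 1%:M :> 'M[K]_(2 + 2)).
Proof.
rewrite sl_involution_half_turn0; apply/eqP => /(congr1 (@ulsubmx _ 2 2 2 2)).
rewrite block_mxKul scalar_mx_block block_mxKul => /matrixP/(_ 0 0).
by rewrite !mxE.
Qed.

Lemma observable_gt1 : (1 < #|{: observable}|)%N.
Proof.
apply/card_gt1P; exists minus_one, (Sub (half_turn 0) half_turn0_proof); split=> //.
suff N1 : - 1%:M != half_turn 0 :> 'M[K]_(2 + 2).
  by apply: contra N1 => /eqP/(congr1 val)/= ->.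
apply/eqP => /(congr1 (@drsubmx _ 2 2 2 2)).
rewrite block_mxKdr scalar_mx_block opp_block_mx block_mxKdr => /matrixP/(_ 0 0).
by rewrite !mxE.
Qed.

End Involutions.

Theorem theoremB (R : realType) :
  exists G1 G2 : sgraph,
    [/\ connected_graph G1 /\ asymmetric G1,
        connected_graph G2 /\ asymmetric G2,
        ~ graph_iso G1 G2
      & quantum_iso R G1 G2].
Proof.
pose G := sys_graph ctx0 ctx1 ctx2 minus_one.
have conn b : connected_graph (G b) by exact: sys_graph_connected.
have asym b : asymmetric (G b).
  exact: sys_graph_asymmetric ctx01 ctx02 ctx12 _ observable_gt1 observable_classical _.
exists (G false), (G true); split=> //.
  exact: sys_graphs_not_iso ctx01 ctx02 ctx12 _ observable_gt1 observable_classical.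
have [v _] : exists s : positive_vector 'F_3 4,
    const_mx 1 = val s \/ const_mx 1 = - val s.
  by apply: pvec_repr F3_two_neq0 _ _; apply/eqP => /matrixP/(_ 0 0); rewrite !mxE.
pose rho (i : observable) := odd_rep R v (val i).
apply: (sys_graph_quantum_iso ctx01 ctx02 ctx12 (rho := rho)).
- by move=> i; apply: star_odd_rep; apply: observable_sqr.
- move=> i; rewrite -(odd_repM F3_two_neq0) ?observable_unit //.
  by rewrite observable_sqr odd_rep1 // F3_two_neq0.
- by move=> q; rewrite /rho -ctxM (odd_repM F3_two_neq0) ?observable_unit.
- exact: (odd_repN1 F3_two_neq0).
Qed.
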